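(* The set of finite TRSs that are confluent (confluent on every term) is $\Pi^0_2$-complete, and the set of finite TRSs that are ground confluent (confluent on every ground term) is $\Pi^0_2$-complete.
   Context: All TRSs are finite sets of rules over a finite signature; terms may contain variables, ground terms contain none. A TRS $R$ is confluent on a term $t$ if for all terms $t_1,t_2$ with $t_1 \leftarrow_R^* t\to_R^* t_2$ there is a term $d$ with $t_1\to_R^* d\leftarrow_R^* t_2$. TRSs and terms are encoded as natural numbers by a standard effective Gödel numbering, and properties are identified with the corresponding sets of codes. $\Sigma^0_n,\Pi^0_n$ are the classes of the arithmetical hierarchy; a set $B$ is $\mathcal P$-complete if $B\in\mathcal P$ and every $A\in\mathcal P$ is many-one reducible to $B$ via a total computable function. *)

(* Defs.v *)
From Stdlib Require Import List Arith Relations Cantor.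
Import ListNotations.

Inductive rf : Type :=
| RZero : rf
| RSucc : rf
| RProj : nat -> rf
| RComp : rf -> list rf -> rf
| RPrec : rf -> rf -> rf
| RMin  : rf -> rf.

Inductive eval : rf -> list nat -> nat -> Prop :=
| ev_zero v : eval RZero v 0
| ev_succ x v : eval RSucc (x :: v) (S x)
| ev_proj i v : i < length v -> eval (RProj i) v (nth i v 0)
| ev_comp f gs v ws y :
    Forall2 (fun g w => eval g v w) gs ws -> eval f ws y ->
    eval (RComp f gs) v y
| ev_prec0 f g v y : eval f v y -> eval (RPrec f g) (0 :: v) y
| ev_precS f g n v z y :
    eval (RPrec f g) (n :: v) z -> eval g (n :: z :: v) y ->
    eval (RPrec f g) (S n :: v) y
| ev_min f n v :
    eval f (n :: v) 0 ->
    (forall m, m < n -> exists k, eval f (m :: v) (S k)) ->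
    eval (RMin f) v n.

Definition computable1 (f : nat -> nat) : Prop :=
  exists p, forall n, eval p [n] (f n).

Definition computable3 (g : nat -> nat -> nat -> nat) : Prop :=
  exists p, forall a b c, eval p [a; b; c] (g a b c).

Definition Pi02 (A : nat -> Prop) : Prop :=
  exists g, computable3 g /\
    forall n, A n <-> (forall x, exists y, g n x y = 0).

Definition many_one_reducible (A B : nat -> Prop) : Prop :=
  exists f, computable1 f /\ forall n, A n <-> B (f n).

Definition Pi02_complete (B : nat -> Prop) : Prop :=
  Pi02 B /\ forall A, Pi02 A -> many_one_reducible A B.

Inductive term : Type :=
| Var : nat -> term
| Fun : nat -> list term -> term.

(* A signature: finite list of function symbols (name, arity). *)
Definition signature := list (nat * nat).

Fixpoint wf_term (sig : signature) (t : term) : Prop :=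
  match t with
  | Var _ => True
  | Fun f ts => In (f, length ts) sig /\
      (fix wfl (l : list term) : Prop :=
         match l with [] => True | u :: l' => wf_term sig u /\ wfl l' end) ts
  end.

Fixpoint vars (t : term) : list nat :=
  match t with
  | Var x => [x]
  | Fun _ ts => (fix vl (l : list term) : list nat :=
                   match l with [] => [] | u :: l' => vars u ++ vl l' end) ts
  end.

Definition ground (t : term) : Prop := vars t = [].

Fixpoint subst (s : nat -> term) (t : term) : term :=
  match t with
  | Var x => s x
  | Fun f ts => Fun f (map (subst s) ts)
  end.

Record TRS : Type := mkTRS {
  trs_sig : signature;
  trs_rules : list (term * term)
}.

Definition wf_trs (R : TRS) : Prop :=
  forall l r, In (l, r) (trs_rules R) ->
    (forall x, l <> Var x) /\
    (forall x, In x (vars r) -> In x (vars l)) /\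
    wf_term (trs_sig R) l /\ wf_term (trs_sig R) r.

Inductive rstep (R : list (term * term)) : term -> term -> Prop :=
| rs_root l r s : In (l, r) R -> rstep R (subst s l) (subst s r)
| rs_ctx f ts1 u v ts2 : rstep R u v ->
    rstep R (Fun f (ts1 ++ u :: ts2)) (Fun f (ts1 ++ v :: ts2)).

Definition rsteps (R : list (term * term)) : term -> term -> Prop :=
  clos_refl_trans term (rstep R).

Definition confluent_on (R : TRS) (t : term) : Prop :=
  forall t1 t2, rsteps (trs_rules R) t t1 -> rsteps (trs_rules R) t t2 ->
    exists d, rsteps (trs_rules R) t1 d /\ rsteps (trs_rules R) t2 d.

Definition confluent (R : TRS) : Prop :=
  forall t, wf_term (trs_sig R) t -> confluent_on R t.

Definition ground_confluent (R : TRS) : Prop :=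
  forall t, wf_term (trs_sig R) t -> ground t -> confluent_on R t.

(* code 0 = [], code (S (to_nat (h, t))) = h :: t *)
Fixpoint dec_nats (fuel n : nat) : list nat :=
  match fuel with
  | 0 => []
  | S k => match n with
           | 0 => []
           | S n' => let (h, t) := of_nat n' in h :: dec_nats k t
           end
  end.

(* code to_nat (0, x) = Var x ; code to_nat (S f, c) = Fun f ts where c
   codes the list of codes of ts *)
Fixpoint dec_term (fuel n : nat) : term :=
  match fuel with
  | 0 => Var 0
  | S k => let (a, b) := of_nat n in
           match a with
           | 0 => Var b
           | S f => Fun f (map (dec_term k) (dec_nats b b))
           end
  end.

Definition decode_term (n : nat) : term := dec_term n n.

Definition decode_trs (n : nat) : TRS :=
  let (a, b) := of_nat n in
  mkTRS (map of_nat (dec_nats a a))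
        (map (fun k => let (x, y) := of_nat k in (decode_term x, decode_term y))
             (dec_nats b b)).

Definition CONF (n : nat) : Prop :=
  wf_trs (decode_trs n) /\ confluent (decode_trs n).

Definition GCONF (n : nat) : Prop :=
  wf_trs (decode_trs n) /\ ground_confluent (decode_trs n).

(* Main.v *)
From Stdlib Require Import List Arith Relations Cantor Lia Classical.
Require Import Defs.
Import ListNotations.

(** Membership: a finite set of Horn clauses over coded facts derives a recursively
    enumerable set of facts, and "[t] is a well-formed (ground) term rewriting to [t1]
    and to [t2]", "[t1] and [t2] are joinable" and "the system is well formed" are
    derivability statements of this kind.

    Hardness: let [A n] mean that for all [x] there is [y] with [g n x y = 0]. An
    orthogonal system [D] simulates [g], and [Run x] reduces to [Done] iff the search for
    [y] succeeds. The difficulty is to branch into [Run x] and [Done] for every numeral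
    [x] without branching on a term that merely looks like a numeral near its root. The
    symbol [Zip] does this: [Zip (S x) a] and [Zip x (S a)] rewrite to each other, and
    [Zip 0 a] rewrites to [Run a] while [Zip x 0] rewrites to [Done]. The shifts can be
    undone, and both exits are reachable only if both arguments are numerals, so a branch
    occurs exactly on numerals. If every search succeeds, the steps of [D] and the
    parallel [Zip] steps (extended by contracting to [Done] every search that succeeds)
    are confluent and commute, and the Hindley-Rosen lemma gives confluence on all terms,
    open or not. If the search for [x] fails, [Run x] and [Done] have no common reduct,
    which already refutes ground confluence. *)

(** * Recursive functions and Horn clauses *)

(** A one-way zipper would not be confluent on open terms: with [y] a variable, [Zip (succ y) zero]
    would reach both [Done] and the stuck term [Zip y (succ zero)]. The reverse rule repairs this
    peak but destroys termination, so local confluence is not enough and diagrams have to close in a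
    controlled number of steps. For this reason the [Zip] side is compressed: any number of shifts,
    a run of shifts followed by an exit, and a whole successful search each count as one step, and
    parallel steps of this kind have the diamond property. Symbols 0 and 1 are the constructors of
    numerals, 2 to 5 are [Zip], [Done], [Run] and [Search], 6 names the parameter, and the symbols
    from 7 on belong to recursive functions. For membership, Horn clauses may guess intermediate
    terms and substitutions, so the only algorithm that has to be shown recursive is the enumeration
    of their consequences. *)

Definition recursive (k : nat) (F : list nat -> nat) : Prop :=
  exists p, forall v, length v = k -> eval p v (F v).

Lemma recursive_ext k F G :
  (forall v, length v = k -> F v = G v) -> recursive k F -> recursive k G.
Proof.
  intros H [p Hp]. exists p. intros v Hv. rewrite <- H by exact Hv. auto.
Qed.

Lemma recursive_nth k i : i < k -> recursive k (fun v => nth i v 0).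
Proof.
  intros H. exists (RProj i). intros v Hv. constructor. lia.
Qed.

Lemma recursive_comp m k F Gs :
  recursive m F -> length Gs = m -> Forall (recursive k) Gs ->
  recursive k (fun v => F (map (fun G => G v) Gs)).
Proof.
  intros [p Hp] Hm HG.
  assert (exists ps, forall v, length v = k ->
            Forall2 (fun g w => eval g v w) ps (map (fun G => G v) Gs)) as [ps Hps].
  { clear Hm. induction HG as [|G Gs [q Hq] _ [ps IH]].
    - exists []. constructor.
    - exists (q :: ps). intros v Hv. simpl. constructor; auto. }
  exists (RComp p ps). intros v Hv. econstructor; eauto.
  apply Hp. rewrite length_map. exact Hm.
Qed.

Lemma recursive_S k F : recursive k F -> recursive k (fun v => S (F v)).
Proof.
  intros H.
  apply (recursive_comp 1 k (fun v => S (nth 0 v 0)) [F]); auto.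
  exists RSucc. intros [|x v] Hv; [discriminate|constructor].
Qed.

Lemma recursive_const k c : recursive k (fun _ => c).
Proof.
  induction c as [|c IH].
  - exists RZero. constructor.
  - apply (recursive_S k (fun _ => c)), IH.
Qed.

Lemma recursive_app1 k g F :
  recursive 1 (fun v => g (nth 0 v 0)) -> recursive k F -> recursive k (fun v => g (F v)).
Proof.
  intros Hg HF. apply (recursive_comp 1 k (fun v => g (nth 0 v 0)) [F]); auto.
Qed.

Lemma recursive_app2 k g F G :
  recursive 2 (fun v => g (nth 0 v 0) (nth 1 v 0)) -> recursive k F -> recursive k G ->
  recursive k (fun v => g (F v) (G v)).
Proof.
  intros Hg HF HG.
  apply (recursive_comp 2 k (fun v => g (nth 0 v 0) (nth 1 v 0)) [F; G]); auto.
Qed.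

Lemma recursive_app3 k g F G H :
  recursive 3 (fun v => g (nth 0 v 0) (nth 1 v 0) (nth 2 v 0)) ->
  recursive k F -> recursive k G -> recursive k H -> recursive k (fun v => g (F v) (G v) (H v)).
Proof.
  intros Hg HF HG HH.
  apply (recursive_comp 3 k (fun v => g (nth 0 v 0) (nth 1 v 0) (nth 2 v 0)) [F; G; H]);
    auto.
Qed.

Lemma recursive_rec k f g N :
  recursive k N -> recursive k f ->
  recursive (S (S k)) (fun w => g (nth 0 w 0) (nth 1 w 0) (skipn 2 w)) ->
  recursive k (fun v => nat_rec (fun _ => nat) (f v) (fun n z => g n z v) (N v)).
Proof.
  intros HN [p Hp] [q Hq].
  assert (recursive (S k) (fun w => nat_rec (fun _ => nat) (f (tl w))
                       (fun n z => g n z (tl w)) (hd 0 w))) as Hr.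
  { exists (RPrec p q). intros [|n v] Hv; [discriminate|].
    injection Hv as Hv. simpl. induction n as [|n IH]; simpl.
    - constructor. auto.
    - econstructor; [exact IH|].
      apply (Hq (n :: _ :: v)). simpl. lia. }
  (* [RPrec] recurses on the head of its argument list, so it is composed with [N] followed by the
     [k] projections, which restore [v]. *)
  apply recursive_ext with (F := fun v => (fun w => nat_rec (fun _ => nat) (f (tl w))
            (fun n z => g n z (tl w)) (hd 0 w))
            (map (fun G => G v) (N :: map (fun i v => nth i v 0) (seq 0 k)))).
  - intros v Hv. simpl.
    assert (map (fun G : list nat -> nat => G v)
              (map (fun i v => nth i v 0) (seq 0 k)) = v) as ->; auto.
    rewrite map_map. clear -Hv. revert k Hv.
    induction v as [|a v IH]; intros [|k] Hv; try discriminate; auto.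
    simpl. f_equal. rewrite <- seq_shift, map_map. apply IH. auto.
  - apply (recursive_comp (S k) k (fun w => nat_rec (fun _ => nat) (f (tl w))
             (fun n z => g n z (tl w)) (hd 0 w))); auto.
    + simpl. rewrite length_map, length_seq. reflexivity.
    + constructor; auto. apply Forall_forall. intros G HG.
      apply in_map_iff in HG as (i & <- & Hi). apply in_seq in Hi.
      apply recursive_nth. lia.
Qed.

Lemma recursive_nth_skipn k i : i < k -> recursive (S (S k)) (fun w => nth i (skipn 2 w) 0).
Proof.
  intros H. apply recursive_ext with (F := fun w => nth (S (S i)) w 0).
  - intros [|a [|b v]] Hv; try discriminate; reflexivity.
  - apply recursive_nth. lia.
Qed.

Lemma recursive_min k F M :
  (forall v, length v = k -> F (M v :: v) = 0 /\
     forall m, m < M v -> F (m :: v) <> 0) ->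
  recursive (S k) F -> recursive k M.
Proof.
  intros HM [p Hp]. exists (RMin p). intros v Hv.
  destruct (HM v Hv) as [H0 Hlt]. constructor.
  - rewrite <- H0. apply Hp. simpl. auto.
  - intros m Hm. exists (pred (F (m :: v))).
    specialize (Hlt m Hm).
    replace (S (pred (F (m :: v)))) with (F (m :: v)) by lia.
    apply Hp. simpl. auto.
Qed.

Create HintDb recursive discriminated.
#[local] Hint Resolve recursive_S recursive_const : recursive.
#[local] Hint Extern 1 (recursive _ (fun v => nth _ v 0)) => apply recursive_nth; simpl; lia : recursive.
#[local] Hint Extern 1 (recursive _ (fun v => nth _ (skipn 2 v) 0)) =>
  apply recursive_nth_skipn; simpl; lia : recursive.

Lemma recursive_add k F G : recursive k F -> recursive k G ->
  recursive k (fun v => F v + G v).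
Proof.
  intros HF HG.
  apply (recursive_ext k (fun v => nat_rec (fun _ => nat) (G v) (fun _ z => S z) (F v))).
  - intros v _. induction (F v); simpl; auto.
  - apply (recursive_rec k G (fun _ z _ => S z)); auto with recursive.
Qed.

Lemma recursive_pred k F : recursive k F -> recursive k (fun v => pred (F v)).
Proof.
  intros HF.
  apply (recursive_ext k (fun v => nat_rec (fun _ => nat) 0 (fun n _ => n) (F v))).
  - intros v _. destruct (F v); auto.
  - apply (recursive_rec k (fun _ => 0) (fun n _ _ => n)); auto with recursive.
Qed.
#[local] Hint Resolve recursive_add recursive_pred : recursive.

Lemma recursive_sub k F G : recursive k F -> recursive k G ->
  recursive k (fun v => F v - G v).
Proof.
  intros HF HG.
  apply (recursive_ext k (fun v => nat_rec (fun _ => nat) (F v) (fun _ z => pred z) (G v))).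
  - intros v _. induction (G v) as [|n IH]; simpl; lia.
  - apply (recursive_rec k F (fun _ z _ => pred z)); auto with recursive.
Qed.

Definition cond (c a b : nat) : nat := match c with 0 => a | S _ => b end.

Lemma recursive_cond k C F G :
  recursive k C -> recursive k F -> recursive k G ->
  recursive k (fun v => cond (C v) (F v) (G v)).
Proof.
  intros HC HF HG. apply (recursive_app3 k cond); auto.
  apply (recursive_ext 3 (fun v => nat_rec (fun _ => nat) (nth 1 v 0)
                    (fun _ _ => nth 2 v 0) (nth 0 v 0))).
  - intros v _. destruct (nth 0 v 0); auto.
  - apply (recursive_rec 3 (fun v => nth 1 v 0) (fun _ _ v => nth 2 v 0)); auto with recursive.
Qed.

(** Triangular numbers, written with the recursion inside [to_nat] so that [pr_eq] holds by
    computation. *)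
Definition tri (n : nat) : nat := nat_rec (fun _ => nat) 0 (fun i m => S i + m) n.

Lemma recursive_tri k F : recursive k F -> recursive k (fun v => tri (F v)).
Proof.
  intros HF. unfold tri.
  apply (recursive_rec k (fun _ => 0) (fun i m _ => S i + m)); auto with recursive.
Qed.
#[local] Hint Resolve recursive_sub recursive_cond recursive_tri : recursive.

(** * Cantor pairing and coded lists *)

Definition pr (a b : nat) : nat := to_nat (a, b).
Definition pfst (n : nat) : nat := fst (of_nat n).
Definition psnd (n : nat) : nat := snd (of_nat n).

Lemma pr_eq a b : pr a b = b + tri (b + a).
Proof. reflexivity. Qed.

Lemma pfst_pr a b : pfst (pr a b) = a.
Proof. unfold pfst, pr. rewrite cancel_of_to. reflexivity. Qed.

Lemma psnd_pr a b : psnd (pr a b) = b.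
Proof. unfold psnd, pr. rewrite cancel_of_to. reflexivity. Qed.

Lemma pr_surj n : pr (pfst n) (psnd n) = n.
Proof.
  unfold pr, pfst, psnd. rewrite <- surjective_pairing. apply cancel_to_of.
Qed.

Lemma recursive_pr k F G : recursive k F -> recursive k G ->
  recursive k (fun v => pr (F v) (G v)).
Proof.
  intros HF HG. apply (recursive_ext k (fun v => G v + tri (G v + F v))).
  - reflexivity.
  - auto with recursive.
Qed.

Lemma tri_S n : tri (S n) = S n + tri n.
Proof. reflexivity. Qed.

Lemma tri_mono a b : a <= b -> tri a <= tri b.
Proof. induction 1; auto. rewrite tri_S. lia. Qed.

(* [pfst n + psnd n] is the least [s] with [n < tri (S s)]. *)
Lemma recursive_diag k F : recursive k F -> recursive k (fun v => pfst (F v) + psnd (F v)).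
Proof.
  intros HF. apply (recursive_app1 k (fun n => pfst n + psnd n)); auto.
  apply recursive_min with (F := fun w => S (nth 1 w 0) - tri (S (nth 0 w 0))).
  - intros v _. simpl nth. set (n := nth 0 v 0).
    assert (n = psnd n + tri (psnd n + pfst n)) as Hn.
    { rewrite <- pr_eq. symmetry. apply pr_surj. }
    rewrite (Nat.add_comm (pfst n)). split.
    + rewrite tri_S. lia.
    + intros m Hm. assert (tri (S m) <= tri (psnd n + pfst n)).
      { apply tri_mono. lia. }
      lia.
  - auto 10 with recursive.
Qed.
#[local] Hint Resolve recursive_pr recursive_diag : recursive.

Lemma recursive_psnd k F : recursive k F -> recursive k (fun v => psnd (F v)).
Proof.
  intros HF.
  apply (recursive_ext k (fun v => F v - tri (pfst (F v) + psnd (F v)))).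
  - intros v _. rewrite <- (pr_surj (F v)) at 1.
    rewrite pr_eq, (Nat.add_comm (pfst _)). lia.
  - auto with recursive.
Qed.

Lemma recursive_pfst k F : recursive k F -> recursive k (fun v => pfst (F v)).
Proof.
  intros HF.
  apply (recursive_ext k (fun v => (pfst (F v) + psnd (F v)) - psnd (F v))).
  - intros v _. lia.
  - auto using recursive_psnd with recursive.
Qed.
#[local] Hint Resolve recursive_pfst recursive_psnd : recursive.

Definition dl (n : nat) : list nat := dec_nats n n.

Lemma pr_ge_r a b : b <= pr a b.
Proof. rewrite pr_eq. lia. Qed.

Lemma pr_ge_l a b : a <= pr a b.
Proof.
  rewrite pr_eq. assert (forall n, n <= tri n) as H.
  { induction n; auto. rewrite tri_S. lia. }
  specialize (H (b + a)). lia.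
Qed.

Lemma dec_nats_fuel k1 k2 n : n <= k1 -> n <= k2 -> dec_nats k1 n = dec_nats k2 n.
Proof.
  revert k2 n. induction k1 as [|k1 IH]; intros [|k2] [|n] H1 H2; try lia; auto.
  simpl. destruct (of_nat n) as [h t] eqn:E. f_equal.
  assert (t <= n). { rewrite <- (pr_surj n). unfold psnd at 1. rewrite E. apply pr_ge_r. }
  apply IH; lia.
Qed.

Lemma dl_cons h t : dl (S (pr h t)) = h :: dl t.
Proof.
  unfold dl. cbn [dec_nats].
  replace (of_nat (pr h t)) with (h, t) by (symmetry; apply cancel_of_to).
  f_equal. apply dec_nats_fuel; auto. apply pr_ge_r.
Qed.

Lemma dl_0 : dl 0 = [].
Proof. reflexivity. Qed.

Lemma list_code_ind (Q : nat -> Prop) :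
  Q 0 -> (forall h t, Q t -> Q (S (pr h t))) -> forall n, Q n.
Proof.
  intros H0 HS n. induction n as [[|n] IH] using lt_wf_ind; auto.
  rewrite <- (pr_surj n). apply HS, IH.
  assert (H := pr_ge_r (pfst n) (psnd n)). rewrite pr_surj in H. lia.
Qed.

Definition ctl (n : nat) : nat := psnd (pred n).
Definition chd (n : nat) : nat := pfst (pred n).
Definition ctls (i n : nat) : nat := nat_rec (fun _ => nat) n (fun _ z => ctl z) i.

(** A list is no longer than its code, so [n] positions are enough; past the end [ctls] is [0] and
    the position is skipped. The sum of the two truncated differences is [0] exactly when the entry
    equals [c]. *)
Definition memf (c n : nat) : nat :=
  nat_rec (fun _ => nat) 0
    (fun i acc => cond (ctls i n) acc
                    (cond ((chd (ctls i n) - c) + (c - chd (ctls i n))) 1 acc)) n.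

Lemma recursive_ctls k F G : recursive k F -> recursive k G ->
  recursive k (fun v => ctls (F v) (G v)).
Proof.
  intros HF HG. unfold ctls, ctl.
  apply (recursive_rec k G (fun _ z _ => psnd (pred z))); auto with recursive.
Qed.
#[local] Hint Resolve recursive_ctls : recursive.

Lemma recursive_memf k F G : recursive k F -> recursive k G ->
  recursive k (fun v => memf (F v) (G v)).
Proof.
  intros HF HG. apply (recursive_app2 k memf); auto. unfold memf, chd.
  apply (recursive_rec 2 (fun _ => 0)
    (fun i acc v => cond (ctls i (nth 1 v 0)) acc
      (cond ((pfst (pred (ctls i (nth 1 v 0))) - nth 0 v 0)
           + (nth 0 v 0 - pfst (pred (ctls i (nth 1 v 0))))) 1 acc)));
  auto 20 with recursive.
Qed.

Lemma ctls_S i h t : ctls (S i) (S (pr h t)) = ctls i t.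
Proof.
  induction i as [|i IH].
  - simpl. unfold ctl. simpl. apply psnd_pr.
  - change (ctl (ctls (S i) (S (pr h t))) = ctl (ctls i t)). congruence.
Qed.

Lemma ctls_0 i : ctls i 0 = 0.
Proof. induction i as [|i IH]; simpl; auto. rewrite IH. reflexivity. Qed.

Lemma in_dl c n : In c (dl n) <-> exists i, i < n /\ ctls i n <> 0 /\ chd (ctls i n) = c.
Proof.
  induction n as [|h t IH] using list_code_ind.
  - rewrite dl_0. split; [intros []|intros (i & ? & _)]. lia.
  - rewrite dl_cons. simpl. rewrite IH. split.
    + intros [->|(i & Hi & Hn & Hc)].
      * exists 0. simpl. unfold chd. simpl. rewrite pfst_pr. repeat split; auto; lia.
      * exists (S i). rewrite ctls_S. assert (Ht := pr_ge_r h t). repeat split; auto; lia.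
    + intros ([|i] & Hi & Hn & Hc).
      * left. simpl in Hc. unfold chd in Hc. simpl in Hc. rewrite pfst_pr in Hc. auto.
      * right. rewrite ctls_S in *. exists i. repeat split; auto.
        (* The bound on [S i] says nothing about [t]. That [i < t] follows from the tail at [i]
           being nonempty, because codes of tails decrease. *)
        clear -Hn. revert i Hn. induction t as [|h' t' IH] using list_code_ind; intros i Hn.
        -- rewrite ctls_0 in Hn. lia.
        -- destruct i; [lia|]. rewrite ctls_S in Hn. apply IH in Hn.
           assert (Ht := pr_ge_r h' t'). lia.
Qed.

Lemma memf_spec c n : memf c n <> 0 <-> In c (dl n).
Proof.
  rewrite in_dl. unfold memf.
  enough (forall b, nat_rec (fun _ => nat) 0
    (fun i acc => cond (ctls i n) acc
       (cond ((chd (ctls i n) - c) + (c - chd (ctls i n))) 1 acc)) b <> 0 <->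
    exists i, i < b /\ ctls i n <> 0 /\ chd (ctls i n) = c) as H by apply H.
  induction b as [|b IH]; simpl.
  - split; [lia|]. intros (i & Hi & _). lia.
  - unfold cond at 1. destruct (ctls b n) as [|z] eqn:E.
    + rewrite IH. split; intros (i & Hi & Hn & Hc).
      * exists i. repeat split; auto.
      * exists i. repeat split; auto. assert (i <> b) by congruence. lia.
    + unfold cond at 1.
      destruct (chd (S z) - c + (c - chd (S z))) eqn:E'.
      * split; [|lia]. intros _. exists b. rewrite E. repeat split; lia.
      * rewrite IH. split; intros (i & Hi & Hn & Hc).
        -- exists i. repeat split; auto.
        -- exists i. repeat split; auto.
           assert (i <> b). { intros ->. rewrite E in Hc. lia. } lia.
Qed.
#[local] Hint Resolve recursive_memf : recursive.

(** * Horn clauses and their staged closure *)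

Definition fn6 := nat -> nat -> nat -> nat -> nat -> nat -> nat.
(** Head and premises are functions of six shared variables, as many as the largest clause below
    has. Guessing an environment takes the place of unification. *)
Definition clause : Type := fn6 * list fn6.

Inductive der (P : list clause) : nat -> Prop :=
| der_intro h bs a b c d e g :
    In (h, bs) P -> Forall (fun q : fn6 => der P (q a b c d e g)) bs ->
    der P (h a b c d e g).

Fixpoint der_ind' (P : list clause) (Q : nat -> Prop)
  (H : forall h bs a b c d e g, In (h, bs) P ->
    Forall (fun q : fn6 => der P (q a b c d e g) /\ Q (q a b c d e g)) bs ->
    Q (h a b c d e g)) n (D : der P n) {struct D} : Q n :=
  match D with
  | der_intro _ h bs a b c d e g Hin F =>
      H h bs a b c d e g Hin
        ((fix go l (F : Forall (fun q : fn6 => der P (q a b c d e g)) l) :=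
            match F in Forall _ l
              return Forall (fun q : fn6 => der P (q a b c d e g) /\
                                            Q (q a b c d e g)) l with
            | Forall_nil _ => Forall_nil _
            | Forall_cons x Hx F' => Forall_cons x (conj Hx (der_ind' P Q H _ Hx)) (go _ F')
            end) bs F)
  end.

Definition env6 (q : fn6) (e : nat) : nat :=
  q (pfst e) (pfst (psnd e)) (pfst (psnd (psnd e)))
    (pfst (psnd (psnd (psnd e)))) (pfst (psnd (psnd (psnd (psnd e)))))
    (psnd (psnd (psnd (psnd (psnd e))))).

Definition recursive6 (q : fn6) : Prop := recursive 1 (fun v => env6 q (nth 0 v 0)).

Definition allmem (bs : list fn6) (e z : nat) : nat :=
  fold_right (fun b acc => cond (memf (env6 b e) z) 0 acc) 1 bs.

Definition stage1 (e : nat) (cl : clause) (z : nat) : nat :=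
  cond (allmem (snd cl) e z) z (S (pr (env6 (fst cl) e) z)).

(* Stage [S m] fires every clause whose body holds in the environment [pfst m];
   each environment is the first component of infinitely many [m]. *)
Definition stages (P : list clause) (m : nat) : nat :=
  nat_rec (fun _ => nat) 0 (fun m z => fold_right (stage1 (pfst m)) z P) m.

Lemma recursive_stages P k F :
  Forall (fun cl => recursive6 (fst cl) /\ Forall recursive6 (snd cl)) P ->
  recursive k F -> recursive k (fun v => stages P (F v)).
Proof.
  intros HP HF. unfold stages.
  apply (recursive_rec k (fun _ => 0) (fun m z _ => fold_right (stage1 (pfst m)) z P));
    auto with recursive.
  induction HP as [|[h bs] P [Hh Hbs] _ IH]; simpl; auto with recursive.
  unfold stage1 at 1. simpl in *.
  assert (forall q, recursive6 q -> recursive (S (S k)) (fun v => env6 q (pfst (nth 0 v 0)))) as H6.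
  { intros q Hq. apply (recursive_app1 _ (env6 q)); auto with recursive. }
  apply recursive_cond; auto with recursive.
  induction Hbs as [|b bs Hb _ IHb]; simpl; auto with recursive.
Qed.

Lemma allmem_spec bs e z :
  allmem bs e z <> 0 <-> Forall (fun b => In (env6 b e) (dl z)) bs.
Proof.
  induction bs as [|b bs IH]; simpl.
  - split; auto.
  - rewrite Forall_cons_iff, <- memf_spec, <- IH. unfold cond.
    destruct (memf (env6 b e) z); lia.
Qed.

Lemma in_stage1 e cl z c :
  In c (dl (stage1 e cl z)) <->
  In c (dl z) \/
  (c = env6 (fst cl) e /\ Forall (fun b => In (env6 b e) (dl z)) (snd cl)).
Proof.
  unfold stage1, cond. destruct (allmem (snd cl) e z) eqn:E.
  - split; auto. intros [H|[_ H]]; auto. apply allmem_spec in H. lia.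
  - rewrite dl_cons. assert (allmem (snd cl) e z <> 0) as H by lia.
    apply allmem_spec in H. simpl. split; intuition.
Qed.

Lemma stage_incl e P z c :
  In c (dl z) -> In c (dl (fold_right (stage1 e) z P)).
Proof.
  intros H. induction P as [|cl P IH]; simpl; auto.
  apply in_stage1. auto.
Qed.

Lemma stages_mono P m m' c :
  m <= m' -> In c (dl (stages P m)) -> In c (dl (stages P m')).
Proof.
  induction 1; auto. intros. simpl. apply stage_incl. auto.
Qed.

Lemma der_stages P c : der P c <-> exists m, In c (dl (stages P m)).
Proof.
  split.
  - revert c. apply der_ind'. intros h bs a b c d e g Hin HF.
    assert (exists m, Forall (fun q : fn6 => In (q a b c d e g) (dl (stages P m))) bs)
      as [m Hm].
    { clear Hin. induction HF as [|q bs [_ [m1 H1]] _ [m2 H2]].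
      - exists 0. constructor.
      - exists (max m1 m2). constructor.
        + apply stages_mono with m1; auto with arith.
        + eapply Forall_impl; [|exact H2]. intros r. apply stages_mono; auto with arith. }
    set (en := pr a (pr b (pr c (pr d (pr e g))))).
    assert (forall q, env6 q en = q a b c d e g) as He.
    { intros q. unfold env6, en. now rewrite ?psnd_pr, ?pfst_pr, ?psnd_pr, ?pfst_pr. }
    (* The index [pr en m] selects the environment [en] and is at least [m], so the premises are
       already present at that stage. *)
    exists (S (pr en m)). simpl. fold (stages P (pr en m)). rewrite pfst_pr.
    assert (Forall (fun q : fn6 => In (q a b c d e g) (dl (stages P (pr en m)))) bs) as Hm'.
    { eapply Forall_impl; [|exact Hm]. intros q. apply stages_mono, pr_ge_r. }
    clear Hm. revert Hin. generalize (stages P (pr en m)) Hm'. clear -He.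
    intros z Hz. induction P as [|cl P IH]; simpl; [intros []|].
    intros [->|Hin]; apply in_stage1; auto.
    right. simpl. rewrite He. split; auto.
    eapply Forall_impl; [|exact Hz]. intros q Hq. simpl. rewrite He. apply stage_incl, Hq.
  - intros [m Hm]. revert c Hm. induction m as [|m IH]; [intros c []|].
    intros c. simpl. fold (stages P m).
    (* The clauses of one stage fire in sequence and may use facts just added by others, hence the
       induction over sublists of [P]. *)
    enough (forall P', incl P' P ->
      In c (dl (fold_right (stage1 (pfst m)) (stages P m) P')) -> der P c) as H
      by (apply H, incl_refl).
    intros P'. revert c. induction P' as [|[h bs] P' IHP]; intros c HP; simpl; auto.
    apply incl_cons_inv in HP as [Hcl HP].
    intros [H|[-> H]]%in_stage1; auto.
    simpl in *. apply der_intro with (bs := bs); auto.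
    eapply Forall_impl; [|exact H]. intros q Hq. apply IHP in Hq; auto.
Qed.

(** An implication between two enumerable statements has the right quantifiers: the stage at which
    [H n x] appears joins the universal quantifier, as the second component of the coded [x], and
    the stage at which [J n x] and [W n] have appeared is the existential [y]. *)
Lemma Pi02_horn P (A : nat -> Prop) (W : nat -> nat) (H J : nat -> nat -> nat) :
  Forall (fun cl => recursive6 (fst cl) /\ Forall recursive6 (snd cl)) P ->
  recursive 1 (fun v => W (nth 0 v 0)) ->
  recursive 2 (fun v => H (nth 0 v 0) (nth 1 v 0)) ->
  recursive 2 (fun v => J (nth 0 v 0) (nth 1 v 0)) ->
  (forall n, A n <-> der P (W n) /\ forall x, der P (H n x) -> der P (J n x)) ->
  Pi02 A.
Proof.
  intros HP HW HH HJ HA.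
  exists (fun n x y =>
    cond (memf (W n) (stages P y)) 1
      (cond (memf (H n (pfst x)) (stages P (psnd x))) 0
        (cond (memf (J n (pfst x)) (stages P y)) 1 0))).
  split.
  - assert (forall k F, recursive k F -> recursive k (fun v => stages P (F v))) as Hst.
    { intros. apply recursive_stages; auto. }
    assert (recursive 3 (fun v =>
      cond (memf (W (nth 0 v 0)) (stages P (nth 2 v 0))) 1
       (cond (memf (H (nth 0 v 0) (pfst (nth 1 v 0))) (stages P (psnd (nth 1 v 0)))) 0
        (cond (memf (J (nth 0 v 0) (pfst (nth 1 v 0))) (stages P (nth 2 v 0))) 1 0))))
      as [p Hp].
    { repeat apply recursive_cond; auto with recursive.
      - apply recursive_memf; auto with recursive. apply (recursive_app1 _ W); auto with recursive.
      - apply recursive_memf; auto with recursive. apply (recursive_app2 _ H); auto with recursive.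
      - apply recursive_memf; auto with recursive. apply (recursive_app2 _ J); auto with recursive. }
    exists p. intros a b c. apply (Hp [a; b; c]). reflexivity.
  - intros n. rewrite HA. split.
    + intros [Hw HHJ] x. apply der_stages in Hw as [y1 Hy1].
      destruct (memf (H n (pfst x)) (stages P (psnd x))) eqn:E.
      * exists y1. apply memf_spec in Hy1. unfold cond.
        destruct (memf (W n) _); lia.
      * assert (der P (J n (pfst x))) as HJ'.
        { apply HHJ. apply der_stages. exists (psnd x). apply memf_spec. lia. }
        apply der_stages in HJ' as [y2 Hy2]. exists (max y1 y2).
        apply stages_mono with (m' := max y1 y2) in Hy1; [|lia].
        apply stages_mono with (m' := max y1 y2) in Hy2; [|lia].
        apply memf_spec in Hy1, Hy2. unfold cond.
        destruct (memf (W n) _); [lia|]. destruct (memf (J n _) _); lia.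
    + intros Hall. split.
      * destruct (Hall 0) as [y Hy]. apply der_stages. exists y. apply memf_spec.
        unfold cond in Hy. destruct (memf (W n) _); lia.
      * intros x Hx. apply der_stages in Hx as [m Hm].
        destruct (Hall (pr x m)) as [y Hy].
        rewrite pfst_pr, psnd_pr in Hy. apply memf_spec in Hm.
        apply der_stages. exists y. apply memf_spec. unfold cond in Hy.
        destruct (memf (W n) _); [lia|]. destruct (memf (H n x) _); [lia|].
        destruct (memf (J n x) _); lia.
Qed.

(** * Rewriting on codes is recursively enumerable *)

Fixpoint term_ind' (Q : term -> Prop) (HV : forall x, Q (Var x))
  (HF : forall f ts, Forall Q ts -> Q (Fun f ts)) (t : term) : Q t :=
  match t with
  | Var x => HV x
  | Fun f ts => HF f ts ((fix go l : Forall Q l :=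
      match l with
      | [] => Forall_nil _
      | u :: l' => Forall_cons u (term_ind' Q HV HF u) (go l')
      end) ts)
  end.

Definition dtl (c : nat) : list term := map decode_term (dl c).

Lemma in_dl_lt h n : In h (dl n) -> h < n.
Proof.
  induction n as [|a t IH] using list_code_ind.
  - intros [].
  - rewrite dl_cons. assert (Hr := pr_ge_r a t). assert (Hl := pr_ge_l a t).
    intros [->|H]; [lia|]. apply IH in H. lia.
Qed.

Lemma pr_S_lt f b : b < pr (S f) b.
Proof.
  rewrite pr_eq. replace (b + S f) with (S (b + f)) by lia. rewrite tri_S. lia.
Qed.

Lemma dec_term_pr k a b :
  dec_term (S k) (pr a b) =
  match a with 0 => Var b | S f => Fun f (map (dec_term k) (dl b)) end.
Proof.
  cbn [dec_term].
  replace (of_nat (pr a b)) with (a, b) by (symmetry; apply cancel_of_to). reflexivity.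
Qed.

Lemma dec_term_fuel k1 k2 n : n <= k1 -> n <= k2 -> dec_term k1 n = dec_term k2 n.
Proof.
  revert k2 n.
  assert (forall k, dec_term k 0 = Var 0) as H0 by (intros []; reflexivity).
  induction k1 as [|k1 IH]; intros [|k2] n H1 H2;
    try (replace n with 0 by lia; rewrite ?H0; reflexivity).
  rewrite <- (pr_surj n) in *. rewrite !dec_term_pr.
  destruct (pfst n) as [|f]; auto. f_equal. apply map_ext_in. intros u Hu.
  apply in_dl_lt in Hu. assert (Hl := pr_S_lt f (psnd n)). apply IH; lia.
Qed.

Lemma dt_var x : decode_term (pr 0 x) = Var x.
Proof.
  unfold decode_term.
  rewrite (dec_term_fuel (pr 0 x) (S (pr 0 x))) by lia. apply dec_term_pr.
Qed.

Lemma dt_fun f c : decode_term (pr (S f) c) = Fun f (dtl c).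
Proof.
  unfold decode_term.
  rewrite (dec_term_fuel (pr (S f) c) (S (pr (S f) c))) by lia.
  rewrite dec_term_pr. f_equal. apply map_ext_in. intros u Hu.
  apply in_dl_lt in Hu. assert (Hl := pr_S_lt f c). apply dec_term_fuel; lia.
Qed.

Lemma dtl_0 : dtl 0 = [].
Proof. reflexivity. Qed.

Lemma dtl_cons h t : dtl (S (pr h t)) = decode_term h :: dtl t.
Proof. unfold dtl. rewrite dl_cons. reflexivity. Qed.

Lemma term_code_cases n :
  (exists x, n = pr 0 x) \/ (exists f c, n = pr (S f) c).
Proof.
  rewrite <- (pr_surj n). destruct (pfst n) as [|f]; eauto.
Qed.

Lemma list_code_cases n : n = 0 \/ (exists h t, n = S (pr h t)).
Proof. induction n using list_code_ind; eauto. Qed.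

(** Clauses relate codes, rewriting relates terms. Injectivity turns an equation between decoded
    terms into an equality of codes, which a clause expresses by repeating a variable. *)
Lemma decode_term_inj s t : decode_term s = decode_term t -> s = t.
Proof.
  remember (decode_term s) as u eqn:Hs. intros Ht. revert s t Hs Ht.
  induction u as [x|f us IH] using term_ind'; intros s t Hs Ht;
    destruct (term_code_cases s) as [(y & ->)|(g & c & ->)];
    destruct (term_code_cases t) as [(z & ->)|(h & c' & ->)];
    rewrite ?dt_var, ?dt_fun in *; try congruence.
  injection Hs as -> ->. injection Ht as -> Ht. f_equal.
  revert c' Ht IH. induction c as [|h1 t1 IHc] using list_code_ind; intros c' Ht IH;
    destruct (list_code_cases c') as [->|(h2 & t2 & ->)];
    rewrite ?dtl_0, ?dtl_cons in *; try congruence.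
  inversion IH; subst. injection Ht as Hh Ht. f_equal. f_equal; auto.
Qed.

Fixpoint encl (l : list nat) : nat :=
  match l with [] => 0 | h :: t => S (pr h (encl t)) end.

Fixpoint enc (t : term) : nat :=
  match t with
  | Var x => pr 0 x
  | Fun f ts => pr (S f) (encl (map enc ts))
  end.

Lemma dl_encl l : dl (encl l) = l.
Proof. induction l; simpl; auto. rewrite dl_cons. congruence. Qed.

Lemma decode_enc t : decode_term (enc t) = t.
Proof.
  induction t as [x|f ts IH] using term_ind'; simpl.
  - apply dt_var.
  - rewrite dt_fun. unfold dtl. rewrite dl_encl, map_map. f_equal.
    induction IH; simpl; congruence.
Qed.

Definition dpair (k : nat) : term * term :=
  (decode_term (pfst k), decode_term (psnd k)).
Definition drules (b : nat) : list (term * term) := map dpair (dl b).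
Definition dsig (a : nat) : signature := map of_nat (dl a).

Lemma decode_trs_pr n : decode_trs n = mkTRS (dsig (pfst n)) (drules (psnd n)).
Proof.
  unfold decode_trs, dsig, drules, pfst, psnd. destruct (of_nat n) as [a b]. simpl.
  f_equal. apply map_ext. intros k. unfold dpair, pfst, psnd.
  destruct (of_nat k). reflexivity.
Qed.

Lemma in_dsig f k a : In (f, k) (dsig a) <-> In (pr f k) (dl a).
Proof.
  unfold dsig. rewrite in_map_iff. split.
  - intros (n & Hn & Hin). unfold pr. rewrite <- Hn, cancel_to_of. exact Hin.
  - intros H. exists (pr f k). split; auto. apply cancel_of_to.
Qed.

Lemma in_drules_pr l r b :
  In (pr l r) (dl b) -> In (decode_term l, decode_term r) (drules b).
Proof.
  intros H. apply in_map_iff. exists (pr l r). split; auto.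
  unfold dpair. rewrite pfst_pr, psnd_pr. reflexivity.
Qed.

Lemma in_drules l r b :
  In (l, r) (drules b) ->
  exists l' r', decode_term l' = l /\ decode_term r' = r /\ In (pr l' r') (dl b).
Proof.
  intros (k & Hk & Hin)%in_map_iff. exists (pfst k), (psnd k).
  rewrite pr_surj. injection Hk as <- <-. auto.
Qed.

Definition varsl (ts : list term) : list nat := flat_map vars ts.

Lemma vars_fun f ts : vars (Fun f ts) = varsl ts.
Proof. induction ts as [|u ts IH]; simpl in *; congruence. Qed.

Lemma wf_fun sig f ts :
  wf_term sig (Fun f ts) <-> In (f, length ts) sig /\ Forall (wf_term sig) ts.
Proof.
  simpl. apply and_iff_compat_l. induction ts as [|u ts IH]; simpl.
  - split; auto.
  - rewrite Forall_cons_iff, IH. reflexivity.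
Qed.

Lemma subst_ext_in s1 s2 t :
  (forall x, In x (vars t) -> s1 x = s2 x) -> subst s1 t = subst s2 t.
Proof.
  induction t as [x|f ts IH] using term_ind'; intros H.
  - apply H. simpl. auto.
  - simpl. f_equal. rewrite vars_fun in H. induction IH; simpl in *; auto.
    f_equal; auto using in_or_app.
Qed.

(** Only the finitely many variables of a rule matter, so a list can stand for a substitution and be
    guessed by a clause. *)
Definition sg (l : list term) (x : nat) : term := nth x l (Var 0).

Definition step1 (R : list (term * term)) (ts us : list term) : Prop :=
  exists l1 u v l2, ts = l1 ++ u :: l2 /\ us = l1 ++ v :: l2 /\ rstep R u v.

Lemma step1_hd R u v ts : rstep R u v -> step1 R (u :: ts) (v :: ts).
Proof. intros H. exists [], u, v, ts. auto. Qed.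

Lemma step1_tl R u ts us : step1 R ts us -> step1 R (u :: ts) (u :: us).
Proof.
  intros (l1 & a & b & l2 & -> & -> & H). exists (u :: l1), a, b, l2. auto.
Qed.

Lemma step1_fun R f ts us : step1 R ts us -> rstep R (Fun f ts) (Fun f us).
Proof. intros (l1 & a & b & l2 & -> & -> & H). now apply rs_ctx. Qed.

(** * Clauses for rewriting and their soundness *)

Definition Mem x L := pr 0 (pr x L).
Definition Len L k := pr 1 (pr L k).
Definition Nth L i x := pr 2 (pr L (pr i x)).
Definition Sub s t u := pr 3 (pr s (pr t u)).
Definition SubL s c c' := pr 4 (pr s (pr c c')).
Definition Step R s t := pr 5 (pr R (pr s t)).
Definition StepL R c c' := pr 6 (pr R (pr c c')).
Definition Steps R s t := pr 7 (pr R (pr s t)).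
Definition Wf a t := pr 8 (pr a t).
Definition WfL a c := pr 9 (pr a c).
Definition Occ x t := pr 10 (pr x t).
Definition OccL x c := pr 11 (pr x c).
Definition VIn r l := pr 12 (pr r l).
Definition VInL c l := pr 13 (pr c l).
Definition WfR a R := pr 14 (pr a R).
Definition Gr t := pr 15 t.
Definition GrL c := pr 16 c.
Definition Hyp a R t t1 t2 := pr 17 (pr a (pr R (pr t (pr t1 t2)))).
Definition GHyp a R t t1 t2 := pr 18 (pr a (pr R (pr t (pr t1 t2)))).
Definition Join R t1 t2 := pr 19 (pr R (pr t1 t2)).

(** Decidable properties such as well-formedness and groundness are treated by enumeration as well.
    The variable [u] in the clause for a root step is the guessed substitution. In the clause for
    [WfR] the left-hand side is coded as [pr (S f) c], which rules out a variable. *)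
Definition rewriting_clauses : list clause :=
  let cl (h : fn6) (bs : list fn6) : clause := (h, bs) in
  [ cl (fun x L _ _ _ _ => Mem x (S (pr x L))) [];
    cl (fun x y L _ _ _ => Mem x (S (pr y L))) [fun x y L _ _ _ => Mem x L];
    cl (fun _ _ _ _ _ _ => Len 0 0) [];
    cl (fun x L k _ _ _ => Len (S (pr x L)) (S k)) [fun x L k _ _ _ => Len L k];
    cl (fun x L _ _ _ _ => Nth (S (pr x L)) 0 x) [];
    cl (fun x y L i _ _ => Nth (S (pr y L)) (S i) x) [fun x y L i _ _ => Nth L i x];
    cl (fun s x t _ _ _ => Sub s (pr 0 x) t) [fun s x t _ _ _ => Nth s x t];
    cl (fun s f c c' _ _ => Sub s (pr (S f) c) (pr (S f) c'))
       [fun s f c c' _ _ => SubL s c c'];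
    cl (fun s _ _ _ _ _ => SubL s 0 0) [];
    cl (fun s t c t' c' _ => SubL s (S (pr t c)) (S (pr t' c')))
       [fun s t c t' c' _ => Sub s t t'; fun s t c t' c' _ => SubL s c c'];
    cl (fun R s t l r u => Step R s t)
       [fun R s t l r u => Mem (pr l r) R; fun R s t l r u => Sub u l s;
        fun R s t l r u => Sub u r t];
    cl (fun R f c c' _ _ => Step R (pr (S f) c) (pr (S f) c'))
       [fun R f c c' _ _ => StepL R c c'];
    cl (fun R t t' c _ _ => StepL R (S (pr t c)) (S (pr t' c)))
       [fun R t t' c _ _ => Step R t t'];
    cl (fun R t c c' _ _ => StepL R (S (pr t c)) (S (pr t c')))
       [fun R t c c' _ _ => StepL R c c'];
    cl (fun R t _ _ _ _ => Steps R t t) [];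
    cl (fun R s t u _ _ => Steps R s u)
       [fun R s t u _ _ => Step R s t; fun R s t u _ _ => Steps R t u];
    cl (fun a x _ _ _ _ => Wf a (pr 0 x)) [];
    cl (fun a f c k _ _ => Wf a (pr (S f) c))
       [fun a f c k _ _ => Len c k; fun a f c k _ _ => Mem (pr f k) a;
        fun a f c k _ _ => WfL a c];
    cl (fun a _ _ _ _ _ => WfL a 0) [];
    cl (fun a t c _ _ _ => WfL a (S (pr t c)))
       [fun a t c _ _ _ => Wf a t; fun a t c _ _ _ => WfL a c];
    cl (fun x _ _ _ _ _ => Occ x (pr 0 x)) [];
    cl (fun x f c _ _ _ => Occ x (pr (S f) c)) [fun x f c _ _ _ => OccL x c];
    cl (fun x t c _ _ _ => OccL x (S (pr t c))) [fun x t c _ _ _ => Occ x t];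
    cl (fun x t c _ _ _ => OccL x (S (pr t c))) [fun x t c _ _ _ => OccL x c];
    cl (fun x l _ _ _ _ => VIn (pr 0 x) l) [fun x l _ _ _ _ => Occ x l];
    cl (fun f c l _ _ _ => VIn (pr (S f) c) l) [fun f c l _ _ _ => VInL c l];
    cl (fun l _ _ _ _ _ => VInL 0 l) [];
    cl (fun t c l _ _ _ => VInL (S (pr t c)) l)
       [fun t c l _ _ _ => VIn t l; fun t c l _ _ _ => VInL c l];
    cl (fun a _ _ _ _ _ => WfR a 0) [];
    cl (fun a f c r R _ => WfR a (S (pr (pr (pr (S f) c) r) R)))
       [fun a f c r R _ => VIn r (pr (S f) c); fun a f c r R _ => Wf a (pr (S f) c);
        fun a f c r R _ => Wf a r; fun a f c r R _ => WfR a R];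
    cl (fun f c _ _ _ _ => Gr (pr (S f) c)) [fun f c _ _ _ _ => GrL c];
    cl (fun _ _ _ _ _ _ => GrL 0) [];
    cl (fun t c _ _ _ _ => GrL (S (pr t c)))
       [fun t c _ _ _ _ => Gr t; fun t c _ _ _ _ => GrL c];
    cl (fun a R t t1 t2 _ => Hyp a R t t1 t2)
       [fun a R t t1 t2 _ => Wf a t; fun a R t t1 t2 _ => Steps R t t1;
        fun a R t t1 t2 _ => Steps R t t2];
    cl (fun a R t t1 t2 _ => GHyp a R t t1 t2)
       [fun a R t t1 t2 _ => Gr t; fun a R t t1 t2 _ => Hyp a R t t1 t2];
    cl (fun R t1 t2 d _ _ => Join R t1 t2)
       [fun R t1 t2 d _ _ => Steps R t1 d; fun R t1 t2 d _ _ => Steps R t2 d] ].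

Lemma recursive6_rewriting_clauses :
  Forall (fun cl => recursive6 (fst cl) /\ Forall recursive6 (snd cl)) rewriting_clauses.
Proof.
  repeat constructor; cbv [fst snd];
    unfold recursive6, env6, Mem, Len, Nth, Sub, SubL, Step, StepL, Steps, Wf, WfL, Occ, OccL,
      VIn, VInL, WfR, Gr, GrL, Hyp, GHyp, Join;
    auto 30 with recursive.
Qed.

(** The invariant for soundness: what the fact coded by [n] asserts about the decoded objects. The
    tag is the first component, and the last case serves tag 19. *)
Definition sem (n : nat) : Prop :=
  let a := psnd n in
  let b := psnd a in
  let c := psnd b in
  match pfst n with
  | 0 => In (pfst a) (dl b)
  | 1 => length (dl (pfst a)) = b
  | 2 => nth_error (dl (pfst a)) (pfst b) = Some c
  | 3 => subst (sg (dtl (pfst a))) (decode_term (pfst b)) = decode_term c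
  | 4 => map (subst (sg (dtl (pfst a)))) (dtl (pfst b)) = dtl c
  | 5 => rstep (drules (pfst a)) (decode_term (pfst b)) (decode_term c)
  | 6 => step1 (drules (pfst a)) (dtl (pfst b)) (dtl c)
  | 7 => rsteps (drules (pfst a)) (decode_term (pfst b)) (decode_term c)
  | 8 => wf_term (dsig (pfst a)) (decode_term b)
  | 9 => Forall (wf_term (dsig (pfst a))) (dtl b)
  | 10 => In (pfst a) (vars (decode_term b))
  | 11 => In (pfst a) (varsl (dtl b))
  | 12 => incl (vars (decode_term (pfst a))) (vars (decode_term b))
  | 13 => incl (varsl (dtl (pfst a))) (vars (decode_term b))
  | 14 => wf_trs (mkTRS (dsig (pfst a)) (drules b))
  | 15 => ground (decode_term a)
  | 16 => varsl (dtl a) = []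
  | 17 => wf_term (dsig (pfst a)) (decode_term (pfst c)) /\
      rsteps (drules (pfst b)) (decode_term (pfst c)) (decode_term (pfst (psnd c))) /\
      rsteps (drules (pfst b)) (decode_term (pfst c)) (decode_term (psnd (psnd c)))
  | 18 => ground (decode_term (pfst c)) /\
      wf_term (dsig (pfst a)) (decode_term (pfst c)) /\
      rsteps (drules (pfst b)) (decode_term (pfst c)) (decode_term (pfst (psnd c))) /\
      rsteps (drules (pfst b)) (decode_term (pfst c)) (decode_term (psnd (psnd c)))
  | _ => exists d, rsteps (drules (pfst a)) (decode_term (pfst b)) d /\
      rsteps (drules (pfst a)) (decode_term c) d
  end.

Lemma wf_trs_cons a l r R :
  wf_trs (mkTRS a ((l, r) :: R)) <->
  (forall x, l <> Var x) /\ incl (vars r) (vars l) /\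
  wf_term a l /\ wf_term a r /\ wf_trs (mkTRS a R).
Proof.
  unfold wf_trs. simpl. split.
  - intros H. destruct (H l r) as (H1 & H2 & H3 & H4); auto.
    repeat split; auto; intros; edestruct H as (? & ? & ? & ?); eauto.
  - intros (H1 & H2 & H3 & H4 & H5) l' r' [E|Hin]; auto.
    injection E as <- <-. auto.
Qed.

Lemma der_sound n : der rewriting_clauses n -> sem n.
Proof.
  revert n. apply der_ind'. intros h bs a b c d e g Hin HF.
  repeat (destruct Hin as [Hin|Hin]; [injection Hin as <- <-|]); [..|destruct Hin];
    repeat match goal with H : Forall _ (_ :: _) |- _ => inversion H; clear H; subst end;
    repeat match goal with H : Forall _ [] |- _ => clear H
                         | H : der _ _ /\ _ |- _ => destruct H as [_ H] end;
    unfold sem, Mem, Len, Nth, Sub, SubL, Step, StepL, Steps, Wf, WfL, Occ, OccL,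
      VIn, VInL, WfR, Gr, GrL, Hyp, GHyp, Join in *;
    repeat (rewrite ?pfst_pr, ?psnd_pr in *; cbv beta iota in * );
    repeat (rewrite ?dl_cons, ?dtl_cons, ?dt_var, ?dt_fun, ?vars_fun, ?wf_fun in * );
    simpl; auto.
  - unfold sg, dtl. now apply nth_error_nth, map_nth_error.
  - congruence.
  - congruence.
  - match goal with H : subst _ _ = decode_term b, H' : subst _ _ = decode_term c |- _ =>
      rewrite <- H, <- H' end.
    apply rs_root, in_drules_pr. assumption.
  - now apply step1_fun.
  - now apply step1_hd.
  - now apply step1_tl.
  - apply rt_refl.
  - eapply rt_trans; [apply rt_step|]; eassumption.
  - rewrite in_dsig. unfold dtl. rewrite length_map. subst. auto.
  - apply in_or_app. auto.
  - apply in_or_app. auto.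
  - intros x [<-|[]]. assumption.
  - apply incl_nil_l.
  - apply incl_app; assumption.
  - intros l r [].
  - unfold drules. rewrite dl_cons. simpl. unfold dpair at 1.
    rewrite pfst_pr, psnd_pr, dt_fun, wf_trs_cons, wf_fun, vars_fun.
    split; [discriminate|]. unfold drules in *. tauto.
  - match goal with H : ground _, H' : varsl _ = [] |- _ => rewrite H, H' end.
    reflexivity.
  - eauto.
Qed.

Lemma der_nth k h bs a b c d e g n :
  nth_error rewriting_clauses k = Some (h, bs) -> n = h a b c d e g ->
  Forall (fun q : fn6 => der rewriting_clauses (q a b c d e g)) bs ->
  der rewriting_clauses n.
Proof.
  intros H -> HF. apply der_intro with bs; auto. eapply nth_error_In; eauto.
Qed.

(* [apply_clause k] uses the clause at position [k], counted from 0, of [rewriting_clauses]. *)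
Ltac apply_clause k a b c d e g :=
  eapply (der_nth k _ _ a b c d e g); [reflexivity|reflexivity|];
  repeat (apply Forall_cons || apply Forall_nil); cbv beta.

(** * Completeness of the clauses *)

Notation derived n := (der rewriting_clauses n).

(** Every number is at once a term code and a list code, so a single strong induction on numbers
    replaces mutual induction on terms and argument lists. *)
Lemma code_ind2 (Q QL : nat -> Prop) :
  (forall x, Q (pr 0 x)) -> (forall f c, QL c -> Q (pr (S f) c)) ->
  QL 0 -> (forall h t, Q h -> QL t -> QL (S (pr h t))) ->
  (forall n, Q n) /\ (forall n, QL n).
Proof.
  intros HV HF H0 HS.
  enough (forall n, Q n /\ QL n) as H by (split; intros n; apply H).
  induction n as [n IH] using lt_wf_ind. split.
  - destruct (term_code_cases n) as [(x & ->)|(f & c & ->)]; auto.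
    apply HF, IH, pr_S_lt.
  - destruct (list_code_cases n) as [->|(h & t & ->)]; auto.
    assert (Hl := pr_ge_l h t). assert (Hr := pr_ge_r h t).
    apply HS; apply IH; lia.
Qed.

Lemma der_Mem x L : In x (dl L) -> derived (Mem x L).
Proof.
  induction L as [|y L IH] using list_code_ind; [intros []|].
  rewrite dl_cons. intros [->|H].
  - apply_clause 0 x L 0 0 0 0.
  - apply_clause 1 x y L 0 0 0. auto.
Qed.

Lemma der_Len L : derived (Len L (length (dl L))).
Proof.
  induction L as [|x L IH] using list_code_ind.
  - apply_clause 2 0 0 0 0 0 0.
  - rewrite dl_cons. apply_clause 3 x L (length (dl L)) 0 0 0. auto.
Qed.

Lemma der_Nth L i x : nth_error (dl L) i = Some x -> derived (Nth L i x).
Proof.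
  revert i. induction L as [|y L IH] using list_code_ind; intros i.
  - rewrite dl_0. destruct i; discriminate.
  - rewrite dl_cons. destruct i as [|i]; simpl; intros H.
    + injection H as ->. apply_clause 4 x L 0 0 0 0.
    + apply_clause 5 x y L i 0 0. auto.
Qed.

(** The bound on the variables reconciles [sg], which has a default outside the list, with [Nth],
    which derives nothing there. *)
Lemma der_Sub s t t' :
  (forall x, In x (vars (decode_term t)) -> x < length (dl s)) ->
  subst (sg (dtl s)) (decode_term t) = decode_term t' -> derived (Sub s t t').
Proof.
  revert t t'.
  enough ((forall t t', (forall x, In x (vars (decode_term t)) -> x < length (dl s)) ->
             subst (sg (dtl s)) (decode_term t) = decode_term t' ->
             derived (Sub s t t')) /\
          (forall c c', (forall x, In x (varsl (dtl c)) -> x < length (dl s)) ->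
             map (subst (sg (dtl s))) (dtl c) = dtl c' -> derived (SubL s c c')))
    as H by apply H.
  apply code_ind2.
  - intros x t' Hx. rewrite dt_var in *. simpl. intros E.
    specialize (Hx x (or_introl eq_refl)).
    apply_clause 6 s x t' 0 0 0. apply der_Nth.
    destruct (nth_error (dl s) x) as [u|] eqn:Eu.
    + unfold sg, dtl in E. rewrite (nth_error_nth _ _ _ (map_nth_error _ _ _ Eu)) in E.
      apply decode_term_inj in E. congruence.
    + apply nth_error_None in Eu. lia.
  - intros f c IH t' Hx. rewrite dt_fun, ?vars_fun in *. simpl. intros E.
    destruct (term_code_cases t') as [(y & ->)|(f' & c' & ->)];
      rewrite ?dt_var, ?dt_fun in E; [discriminate|]. injection E as <- E.
    apply_clause 7 s f c c' 0 0. auto.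
  - intros c' _. rewrite dtl_0. intros E.
    destruct (list_code_cases c') as [->|(h & t & ->)].
    + apply_clause 8 s 0 0 0 0 0.
    + rewrite dtl_cons in E. discriminate.
  - intros h t IHh IHt c' Hx. rewrite dtl_cons in *. intros E.
    destruct (list_code_cases c') as [->|(h' & t' & ->)].
    + discriminate.
    + rewrite dtl_cons in E. injection E as Eh Et. apply_clause 9 s h t h' t' 0.
      * apply IHh; auto. intros x H. apply Hx. simpl. apply in_or_app. auto.
      * apply IHt; auto. intros x H. apply Hx. simpl. apply in_or_app. auto.
Qed.

Lemma vars_bound (l : list nat) : exists N, forall x, In x l -> x < N.
Proof.
  induction l as [|a l [N IH]].
  - exists 0. intros x [].
  - exists (S (a + N)). intros x [->|H]; [lia|]. apply IH in H. lia.
Qed.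

Lemma der_Step R u v :
  rstep (drules R) u v ->
  forall s t, decode_term s = u -> decode_term t = v -> derived (Step R s t).
Proof.
  induction 1 as [l r s0 Hin|f ts1 u v ts2 Huv IH]; intros s t Hs Ht.
  - apply in_drules in Hin as (l' & r' & <- & <- & Hin).
    destruct (vars_bound (vars (decode_term l') ++ vars (decode_term r'))) as [N HN].
    (* The substitution is coded on the variables below [N], which include all variables of the
       rule. *)
    set (sc := encl (map (fun x => enc (s0 x)) (seq 0 N))).
    assert (length (dl sc) = N) as Hlen.
    { unfold sc. rewrite dl_encl, length_map, length_seq. reflexivity. }
    assert (forall x, x < N -> sg (dtl sc) x = s0 x) as Hsg.
    { intros x Hx. unfold sg, dtl, sc. rewrite dl_encl, map_map.
      apply nth_error_nth. rewrite nth_error_map, nth_error_seq.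
      destruct (Nat.ltb_spec x N); [|lia]. simpl. f_equal. apply decode_enc. }
    apply_clause 10 R s t l' r' sc.
    + apply der_Mem, Hin.
    + apply der_Sub.
      * intros x Hx. rewrite Hlen. apply HN, in_or_app. auto.
      * rewrite Hs. apply subst_ext_in. intros x Hx. apply Hsg, HN, in_or_app. auto.
    + apply der_Sub.
      * intros x Hx. rewrite Hlen. apply HN, in_or_app. auto.
      * rewrite Ht. apply subst_ext_in. intros x Hx. apply Hsg, HN, in_or_app. auto.
  - destruct (term_code_cases s) as [(y & ->)|(g & c & ->)];
      rewrite ?dt_var, ?dt_fun in Hs; [discriminate|]. injection Hs as -> Hc.
    destruct (term_code_cases t) as [(y & ->)|(g & c' & ->)];
      rewrite ?dt_var, ?dt_fun in Ht; [discriminate|]. injection Ht as -> Hc'.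
    apply_clause 11 R f c c' 0 0. revert c c' Hc Hc'.
    induction ts1 as [|a ts1 IH1]; simpl; intros c c' Hc Hc';
      destruct (list_code_cases c) as [->|(h & w & ->)]; try discriminate;
      destruct (list_code_cases c') as [->|(h' & w' & ->)]; try discriminate;
      rewrite dtl_cons in *; injection Hc as Hh Hw; injection Hc' as Hh' Hw'.
    (* Injectivity is known for term codes only, so both list codes are placed under a function
       symbol. *)
    + assert (w = w') as <-.
      { assert (decode_term (pr 1 w) = decode_term (pr 1 w')) as E
          by (rewrite !dt_fun; congruence).
        apply decode_term_inj in E. rewrite <- (psnd_pr 1 w), E. apply psnd_pr. }
      apply_clause 12 R h h' w 0 0. auto.
    + rewrite <- Hh' in Hh. apply decode_term_inj in Hh as <-.
      apply_clause 13 R h w w' 0 0. auto.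
Qed.

Lemma der_Steps R s t :
  rsteps (drules R) (decode_term s) (decode_term t) -> derived (Steps R s t).
Proof.
  intros H. apply clos_rt_rt1n in H. revert H.
  generalize (eq_refl (decode_term s)) (eq_refl (decode_term t)).
  generalize (decode_term s) at 1 3 as u. generalize (decode_term t) at 1 3 as v.
  intros v u Hu Hv H. revert s t Hu Hv. induction H as [u|u w v Huw _ IH]; intros s t Hu Hv.
  - assert (s = t) as <- by (apply decode_term_inj; congruence).
    apply_clause 14 R s 0 0 0 0.
  - apply_clause 15 R s (enc w) t 0 0.
    + eapply der_Step; eauto using decode_enc.
    + apply IH; auto using decode_enc.
Qed.

Lemma der_Wf a t : wf_term (dsig a) (decode_term t) -> derived (Wf a t).
Proof.
  revert t.
  enough ((forall t, wf_term (dsig a) (decode_term t) -> derived (Wf a t)) /\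
          (forall c, Forall (wf_term (dsig a)) (dtl c) -> derived (WfL a c)))
    as H by apply H.
  apply code_ind2.
  - intros x _. apply_clause 16 a x 0 0 0 0.
  - intros f c IH. rewrite dt_fun, wf_fun, in_dsig. unfold dtl at 1. rewrite length_map.
    intros [Hf Hc]. apply_clause 17 a f c (length (dl c)) 0 0; auto using der_Len, der_Mem.
  - intros _. apply_clause 18 a 0 0 0 0 0.
  - intros h t IHh IHt. rewrite dtl_cons, Forall_cons_iff. intros [Hh Ht].
    apply_clause 19 a h t 0 0 0; auto.
Qed.

Lemma der_Occ x t : In x (vars (decode_term t)) -> derived (Occ x t).
Proof.
  revert t.
  enough ((forall t, In x (vars (decode_term t)) -> derived (Occ x t)) /\
          (forall c, In x (varsl (dtl c)) -> derived (OccL x c)))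
    as H by apply H.
  apply code_ind2.
  - intros y. rewrite dt_var. intros [->|[]]. apply_clause 20 x 0 0 0 0 0.
  - intros f c IH. rewrite dt_fun, vars_fun. intros H. apply_clause 21 x f c 0 0 0. auto.
  - intros [].
  - intros h t IHh IHt. rewrite dtl_cons. simpl. intros [H|H]%in_app_or.
    + apply_clause 22 x h t 0 0 0. auto.
    + apply_clause 23 x h t 0 0 0. auto.
Qed.

Lemma der_VIn r l :
  incl (vars (decode_term r)) (vars (decode_term l)) -> derived (VIn r l).
Proof.
  revert r.
  enough ((forall r, incl (vars (decode_term r)) (vars (decode_term l)) ->
             derived (VIn r l)) /\
          (forall c, incl (varsl (dtl c)) (vars (decode_term l)) -> derived (VInL c l)))
    as H by apply H.
  apply code_ind2.
  - intros y. rewrite dt_var. intros H. apply_clause 24 y l 0 0 0 0.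
    apply der_Occ, H. simpl. auto.
  - intros f c IH. rewrite dt_fun, vars_fun. intros H. apply_clause 25 f c l 0 0 0. auto.
  - intros _. apply_clause 26 l 0 0 0 0 0.
  - intros h t IHh IHt. rewrite dtl_cons. simpl. intros [H1 H2]%incl_app_inv.
    apply_clause 27 h t l 0 0 0; auto.
Qed.

Lemma der_WfR a R : wf_trs (mkTRS (dsig a) (drules R)) -> derived (WfR a R).
Proof.
  induction R as [|k R IH] using list_code_ind.
  - intros _. apply_clause 28 a 0 0 0 0 0.
  - unfold drules. rewrite dl_cons. simpl. unfold dpair at 1. rewrite wf_trs_cons.
    intros (H1 & H2 & H3 & H4 & H5).
    rewrite <- (pr_surj k). generalize dependent (psnd k). intros r H2 H4.
    destruct (term_code_cases (pfst k)) as [(x & E)|(f & c & E)]; rewrite E in *.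
    { exfalso. apply (H1 x), dt_var. }
    apply_clause 29 a f c r R 0; auto using der_VIn, der_Wf.
Qed.

Lemma der_Gr t : ground (decode_term t) -> derived (Gr t).
Proof.
  revert t.
  enough ((forall t, ground (decode_term t) -> derived (Gr t)) /\
          (forall c, varsl (dtl c) = [] -> derived (GrL c)))
    as H by apply H.
  unfold ground. apply code_ind2.
  - intros y. rewrite dt_var. discriminate.
  - intros f c IH. rewrite dt_fun, vars_fun. intros H. apply_clause 30 f c 0 0 0 0. auto.
  - intros _. apply_clause 31 0 0 0 0 0 0.
  - intros h t IHh IHt. rewrite dtl_cons. simpl. intros [H1 H2]%app_eq_nil.
    apply_clause 32 h t 0 0 0 0; auto.
Qed.

Lemma der_Hyp a R t t1 t2 :
  derived (Hyp a R t t1 t2) <->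
  wf_term (dsig a) (decode_term t) /\
  rsteps (drules R) (decode_term t) (decode_term t1) /\
  rsteps (drules R) (decode_term t) (decode_term t2).
Proof.
  split.
  - intros H%der_sound. unfold Hyp, sem in H.
    repeat (rewrite ?pfst_pr, ?psnd_pr in H; cbv beta iota in H). exact H.
  - intros (H1 & H2 & H3). apply_clause 33 a R t t1 t2 0; auto using der_Wf, der_Steps.
Qed.

Lemma der_GHyp a R t t1 t2 :
  derived (GHyp a R t t1 t2) <->
  ground (decode_term t) /\ derived (Hyp a R t t1 t2).
Proof.
  rewrite der_Hyp. split.
  - intros H%der_sound. unfold GHyp, sem in H.
    repeat (rewrite ?pfst_pr, ?psnd_pr in H; cbv beta iota in H). exact H.
  - intros (H1 & H2). apply_clause 34 a R t t1 t2 0; auto using der_Gr. apply der_Hyp; auto.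
Qed.

Lemma der_Join R t1 t2 :
  derived (Join R t1 t2) <->
  exists d, rsteps (drules R) (decode_term t1) d /\ rsteps (drules R) (decode_term t2) d.
Proof.
  split.
  - intros H%der_sound. unfold Join, sem in H.
    repeat (rewrite ?pfst_pr, ?psnd_pr in H; cbv beta iota in H). exact H.
  - intros (d & H1 & H2). rewrite <- (decode_enc d) in H1, H2.
    apply_clause 35 R t1 t2 (enc d) 0 0; auto using der_Steps.
Qed.

Lemma der_WfR_iff a R :
  derived (WfR a R) <-> wf_trs (mkTRS (dsig a) (drules R)).
Proof.
  split; [|apply der_WfR].
  intros H%der_sound. unfold WfR, sem in H.
  repeat (rewrite ?pfst_pr, ?psnd_pr in H; cbv beta iota in H). exact H.
Qed.

(** * Membership of both sets in the class *)

Lemma Pi02_CONF : Pi02 CONF.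
Proof.
  apply (Pi02_horn rewriting_clauses CONF (fun n => WfR (pfst n) (psnd n))
    (fun n x => Hyp (pfst n) (psnd n) (pfst x) (pfst (psnd x)) (psnd (psnd x)))
    (fun n x => Join (psnd n) (pfst (psnd x)) (psnd (psnd x))));
    [apply recursive6_rewriting_clauses|unfold WfR, Hyp, Join; auto 20 with recursive..|].
  intros n. unfold CONF. rewrite decode_trs_pr, der_WfR_iff. apply and_iff_compat_l.
  split.
  - intros H x. rewrite der_Hyp, der_Join. intros (H1 & H2 & H3). eapply H; eauto.
  - intros H t Ht t1 t2 H1 H2. simpl in *.
    specialize (H (pr (enc t) (pr (enc t1) (enc t2)))).
    rewrite der_Hyp, der_Join, ?psnd_pr, ?pfst_pr, ?psnd_pr, !decode_enc in H. auto.
Qed.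

Lemma Pi02_GCONF : Pi02 GCONF.
Proof.
  apply (Pi02_horn rewriting_clauses GCONF (fun n => WfR (pfst n) (psnd n))
    (fun n x => GHyp (pfst n) (psnd n) (pfst x) (pfst (psnd x)) (psnd (psnd x)))
    (fun n x => Join (psnd n) (pfst (psnd x)) (psnd (psnd x))));
    [apply recursive6_rewriting_clauses|unfold WfR, GHyp, Join; auto 20 with recursive..|].
  intros n. unfold GCONF. rewrite decode_trs_pr, der_WfR_iff. apply and_iff_compat_l.
  split.
  - intros H x. rewrite der_GHyp, der_Hyp, der_Join. intros (H0 & H1 & H2 & H3).
    eapply H; eauto.
  - intros H t Ht Hg t1 t2 H1 H2. simpl in *.
    specialize (H (pr (enc t) (pr (enc t1) (enc t2)))).
    rewrite der_GHyp, der_Hyp, der_Join, ?psnd_pr, ?pfst_pr, ?psnd_pr, !decode_enc in H.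
    auto.
Qed.

(** * Confluence of programs defined by case distinction *)

Notation star r := (clos_refl_trans term r).

(** * Commutation of abstract relations *)

Section Abstract.
Context {X : Type}.
Implicit Types A B : relation X.
Notation rt := (clos_refl_trans X).

Definition commute A B : Prop :=
  forall t s u, A t s -> B t u -> exists w, B s w /\ A u w.

Lemma commute_sym A B : commute A B -> commute B A.
Proof. intros H t s u H1 H2. destruct (H t u s H2 H1) as (w & ? & ?). eauto. Qed.

(** Only the [A] side of the closing diagram may use many steps. The [B] step stays single, so it
    can be pushed along a sequence of [A] steps by induction. *)
Lemma commute_rt_l A B :
  (forall t s u, A t s -> B t u -> exists w, B s w /\ rt A u w) -> commute (rt A) B.
Proof.
  intros H t s u Hts. revert u. apply clos_rt_rt1n in Hts.
  induction Hts as [t|t s1 s Hts1 _ IH]; intros u Htu.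
  - exists u. split; auto using rt_refl.
  - destruct (H _ _ _ Hts1 Htu) as (w1 & Hw1 & Huw1).
    destruct (IH _ Hw1) as (w & Hw & Hw1w).
    exists w. split; auto. eapply rt_trans; eauto.
Qed.

Lemma commute_rt A B : commute A B -> commute (rt A) (rt B).
Proof.
  intros H. apply commute_rt_l. intros t s u Hts Htu.
  enough (commute (rt B) A) as HBA.
  { destruct (HBA _ _ _ Htu Hts) as (w & Hw & Hsw). eauto using rt_step. }
  apply commute_rt_l. intros t' s' u' H1 H2.
  destruct (commute_sym _ _ H _ _ _ H1 H2) as (w & ? & ?). eauto using rt_step.
Qed.

Lemma union_confluent A B :
  (forall t, A t t) -> (forall t, B t t) ->
  commute A A -> commute B B -> commute A B ->
  commute (rt (union X A B)) (rt (union X A B)).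
Proof.
  intros rA rB HA HB HAB. apply commute_rt.
  intros t s u [Hs|Hs] [Hu|Hu].
  - destruct (HA _ _ _ Hs Hu) as (w & ? & ?). exists w. split; left; auto.
  - destruct (HAB _ _ _ Hs Hu) as (w & ? & ?). exists w. split; [right|left]; auto.
  - destruct (HAB _ _ _ Hu Hs) as (w & ? & ?). exists w. split; [left|right]; auto.
  - destruct (HB _ _ _ Hs Hu) as (w & ? & ?). exists w. split; right; auto.
Qed.
End Abstract.

(** * Numerals, contextual steps and parallel steps *)

Definition zero : term := Fun 0 [].
Definition succ (t : term) : term := Fun 1 [t].
Definition succs (n : nat) (t : term) : term := Nat.iter n succ t.
Definition num (n : nat) : term := succs n zero.

Lemma succs_add i j t : succs (i + j) t = succs i (succs j t).
Proof. apply Nat.iter_add. Qed.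

Lemma succs_inj k t u : succs k t = succs k u -> t = u.
Proof. induction k; simpl; auto. intros H. injection H. auto. Qed.

Lemma num_inj i j : num i = num j -> i = j.
Proof.
  revert j. induction i as [|i IH]; intros [|j] H; try discriminate; auto.
  injection H as H. f_equal. apply IH, H.
Qed.

Lemma subst_num s n : subst s (num n) = num n.
Proof. induction n as [|n IH]; simpl; auto. unfold succ. simpl in *. congruence. Qed.

Inductive ctx (rho : relation term) : relation term :=
| ctx_root t u : rho t u -> ctx rho t u
| ctx_arg f l1 u v l2 : ctx rho u v ->
    ctx rho (Fun f (l1 ++ u :: l2)) (Fun f (l1 ++ v :: l2)).

(* Parallel steps contract the arguments first and then possibly the root, so
   that redexes created at the root may be contracted too. *)
Inductive par (rho : relation term) : relation term :=
| par_var x : par rho (Var x) (Var x)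
| par_fun f ts us : Forall2 (par rho) ts us -> par rho (Fun f ts) (Fun f us)
| par_root f ts us u : Forall2 (par rho) ts us -> rho (Fun f us) u ->
    par rho (Fun f ts) u.

(** The symbols 0 and 1 are constructors: no root step starts at [zero] or [succ t], so numerals are
    normal and a prefix of successors is never lost. *)
Definition defined (rho : relation term) : Prop :=
  forall t u, rho t u -> exists f ts, t = Fun f ts /\ 1 < f.

Section Closures.
Variable rho : relation term.
Hypothesis Hdef : defined rho.

Lemma par_refl t : par rho t t.
Proof.
  induction t as [x|f ts IH] using term_ind'; constructor. induction IH; auto.
Qed.

Lemma pars_refl ts : Forall2 (par rho) ts ts.
Proof. induction ts; auto using par_refl. Qed.

Lemma par_of_root t u : rho t u -> par rho t u.
Proof.
  intros H. destruct (Hdef _ _ H) as (f & ts & -> & _).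
  apply par_root with ts; auto using pars_refl.
Qed.

Lemma par_of_ctx t u : ctx rho t u -> par rho t u.
Proof.
  induction 1; auto using par_of_root.
  constructor. apply Forall2_app; auto using pars_refl.
Qed.

Lemma star_arg f l1 u v l2 :
  star (ctx rho) u v -> star (ctx rho) (Fun f (l1 ++ u :: l2)) (Fun f (l1 ++ v :: l2)).
Proof.
  induction 1; eauto using rt_refl, rt_trans. apply rt_step. now constructor.
Qed.

Lemma star_args f ts us :
  Forall2 (star (ctx rho)) ts us -> star (ctx rho) (Fun f ts) (Fun f us).
Proof.
  intros H. change ts with ([] ++ ts). change us with ([] ++ us).
  generalize (@nil term) as l. induction H as [|t u ts us Ht _ IH]; intros l.
  - apply rt_refl.
  - apply rt_trans with (Fun f (l ++ u :: ts)); auto using star_arg.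
    specialize (IH (l ++ [u])). rewrite <- !app_assoc in IH. exact IH.
Qed.

Lemma star_succs k t u : star (ctx rho) t u -> star (ctx rho) (succs k t) (succs k u).
Proof. induction k; simpl; auto. intros. apply star_args. auto. Qed.

Lemma star_of_par t u : par rho t u -> star (ctx rho) t u.
Proof.
  revert u. induction t as [x|f ts IH] using term_ind'; intros u H.
  - inversion H. apply rt_refl.
  - assert (forall us, Forall2 (par rho) ts us -> star (ctx rho) (Fun f ts) (Fun f us)) as Hc.
    { intros us Hus. apply star_args. revert IH Hus. clear. intros IH Hus.
      induction Hus; inversion IH; subst; auto. }
    inversion H; subst; auto.
    eapply rt_trans; eauto. apply rt_step. now constructor.
Qed.

Lemma par_subst s1 s2 t :
  (forall x, par rho (s1 x) (s2 x)) -> par rho (subst s1 t) (subst s2 t).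
Proof.
  intros H. induction t as [x|f ts IH] using term_ind'; simpl; auto.
  constructor. induction IH; simpl; auto.
Qed.

Lemma star_subst s1 s2 t :
  (forall x, star (ctx rho) (s1 x) (s2 x)) -> star (ctx rho) (subst s1 t) (subst s2 t).
Proof.
  intros H. induction t as [x|f ts IH] using term_ind'; simpl; auto.
  apply star_args. induction IH; simpl; auto.
Qed.

Lemma ctx_fun_inv f ts u : f <= 1 -> ctx rho (Fun f ts) u ->
  exists l1 a b l2, ts = l1 ++ a :: l2 /\ u = Fun f (l1 ++ b :: l2) /\ ctx rho a b.
Proof.
  intros Hf H. inversion H; subst.
  - destruct (Hdef _ _ H0) as (g & us & E & Hg). injection E as -> _. lia.
  - eauto 8.
Qed.

Lemma ctx_zero u : ~ ctx rho zero u.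
Proof.
  intros H. apply ctx_fun_inv in H as ([|] & a & b & l2 & E & _); auto; discriminate.
Qed.

Lemma ctx_succ t u : ctx rho (succ t) u -> exists t', u = succ t' /\ ctx rho t t'.
Proof.
  intros H. apply ctx_fun_inv in H as ([|c l1] & a & b & l2 & E & -> & H); auto;
    simpl in E; injection E as E1 E2.
  - subst. exists b. auto.
  - destruct l1; discriminate.
Qed.

Lemma star_zero u : star (ctx rho) zero u -> u = zero.
Proof.
  intros H. apply clos_rt_rt1n in H. inversion H; auto. now apply ctx_zero in H0.
Qed.

Lemma star_succ t u :
  star (ctx rho) (succ t) u -> exists t', u = succ t' /\ star (ctx rho) t t'.
Proof.
  intros H. apply clos_rt_rt1n in H. remember (succ t) as v eqn:E. revert t E.
  induction H as [v|v w u Hvw _ IH]; intros t ->.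
  - eauto using rt_refl.
  - apply ctx_succ in Hvw as (t1 & -> & H1).
    destruct (IH t1 eq_refl) as (t' & -> & H2). eauto using rt_trans, rt_step.
Qed.

Lemma star_succs_inv k t u :
  star (ctx rho) (succs k t) u -> exists t', u = succs k t' /\ star (ctx rho) t t'.
Proof.
  revert u. induction k as [|k IH]; simpl; intros u H; eauto.
  apply star_succ in H as (u' & -> & H). apply IH in H as (t' & -> & H). eauto.
Qed.

Lemma star_num k u : star (ctx rho) (num k) u -> u = num k.
Proof.
  intros H. apply star_succs_inv in H as (t' & -> & H).
  apply star_zero in H as ->. reflexivity.
Qed.

Lemma par_zero u : par rho zero u -> u = zero.
Proof. intros H. now apply star_zero, star_of_par. Qed.

Lemma par_succ t u : par rho (succ t) u -> exists t', u = succ t' /\ par rho t t'.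
Proof.
  intros H. inversion H as [| ? ? us Hus|? ? us ? Hus Hr]; subst.
  - inversion Hus as [|? t' ? us' Ht Hn]; subst. inversion Hn; subst. exists t'. auto.
  - destruct (Hdef _ _ Hr) as (g & us' & E & Hg). injection E as <- _. lia.
Qed.

Lemma par_succs k t u :
  par rho (succs k t) u -> exists t', u = succs k t' /\ par rho t t'.
Proof.
  revert u. induction k as [|k IH]; simpl; intros u H; eauto.
  apply par_succ in H as (u' & -> & H). apply IH in H as (t' & -> & H). eauto.
Qed.

Lemma succs_par k t u : par rho t u -> par rho (succs k t) (succs k u).
Proof. induction k; simpl; auto. intros. apply par_fun. auto. Qed.

Lemma par_num k u : par rho (num k) u -> u = num k.
Proof. intros H. now apply star_num, star_of_par. Qed.
End Closures.

(** * Programs and their confluence *)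

Inductive def : Type :=
| Plain (k : nat) (r : term)
| Case (k : nat) (r0 r1 : term).

Definition def_rhs (d : def) : list term :=
  match d with Plain _ r => [r] | Case _ r0 r1 => [r0; r1] end.

Definition program := list (nat * def).

(* [Case k r0 r1] matches a first argument [zero] or [succ (Var 0)], followed by the
   [k] arguments [Var 1], ..., [Var k]. *)
Definition def_rules (fd : nat * def) : list (term * term) :=
  match fd with
  | (f, Plain k r) => [(Fun f (map Var (seq 0 k)), r)]
  | (f, Case k r0 r1) =>
      [(Fun f (zero :: map Var (seq 1 k)), r0);
       (Fun f (succ (Var 0) :: map Var (seq 1 k)), r1)]
  end.

Definition asg (ts : list term) (x : nat) : term := nth x ts zero.

(** Root steps read off the argument list instead of a matching substitution, which keeps the effect
    of reducing arguments visible. [oroot_rule] and [rule_oroot] identify them with rule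
    instances. *)
Inductive oroot (D : program) : relation term :=
| or_plain f k r ts : In (f, Plain k r) D -> length ts = k ->
    oroot D (Fun f ts) (subst (asg ts) r)
| or_zero f k r0 r1 ts : In (f, Case k r0 r1) D -> length ts = k ->
    oroot D (Fun f (zero :: ts)) (subst (asg (zero :: ts)) r0)
| or_succ f k r0 r1 t ts : In (f, Case k r0 r1) D -> length ts = k ->
    oroot D (Fun f (succ t :: ts)) (subst (asg (t :: ts)) r1).

Lemma Forall2_asg (Q : relation term) ts us :
  Q zero zero -> Forall2 Q ts us -> forall x, Q (asg ts x) (asg us x).
Proof.
  intros H0 H. unfold asg.
  induction H as [|t u ts us Ht _ IH]; intros [|x]; simpl; auto.
Qed.

Section Program.
Variable D : program.
Hypothesis Dfun : forall f d d', In (f, d) D -> In (f, d') D -> d = d'.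
Hypothesis Dname : forall f d, In (f, d) D -> 3 < f.

Notation O := (ctx (oroot D)).

Lemma oroot_name f ts u : oroot D (Fun f ts) u -> 3 < f.
Proof. inversion 1; subst; eauto. Qed.

Lemma oroot_defined : defined (oroot D).
Proof.
  intros t u H. destruct H; eexists _, _; split; eauto;
    match goal with H : In _ D |- _ => apply Dname in H; lia end.
Qed.

Lemma oroot_det t u v : oroot D t u -> oroot D t v -> u = v.
Proof.
  intros H1 H2. destruct H1; inversion H2; subst;
    match goal with H : In (?f, _) D, H' : In (?f, _) D |- _ =>
      pose proof (Dfun _ _ _ H H') end; congruence.
Qed.

(** Patterns are linear and inspect one constructor at most. Constructors survive reduction, so the
    same rule still applies to the reduced arguments. *)
Lemma oroot_star f ts us u :
  oroot D (Fun f ts) u -> Forall2 (star O) ts us ->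
  exists v, oroot D (Fun f us) v /\ star O u v.
Proof.
  intros H HF.
  assert (forall r ts us, Forall2 (star O) ts us ->
            star O (subst (asg ts) r) (subst (asg us) r)) as Hs.
  { intros. apply star_subst, Forall2_asg; auto using rt_refl. }
  inversion H; subst.
  - eexists. split; [eapply or_plain; eauto using Forall2_length|auto].
    symmetry. eapply Forall2_length; eauto.
  - inversion HF as [|? z ? us' Hz HF']; subst.
    apply (star_zero _ oroot_defined) in Hz as ->.
    eexists. split; [eapply or_zero; eauto|apply Hs; auto using rt_refl].
    symmetry. eapply Forall2_length; eauto.
  - inversion HF as [|? z ? us' Hz HF']; subst.
    apply (star_succ _ oroot_defined) in Hz as (t' & -> & Ht).
    eexists. split; [eapply or_succ; eauto|apply Hs; auto].
    symmetry. eapply Forall2_length; eauto.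
Qed.

(** The argument is that of [oroot_star], for any [rho] that respects constructors. The right-hand
    side is exposed because [zip_program_commute] has to inspect its root symbol. *)
Lemma oroot_par rho f ts us u :
  defined rho -> oroot D (Fun f ts) u -> Forall2 (par rho) ts us ->
  exists d r s1 s2, In (f, d) D /\ In r (def_rhs d) /\ u = subst s1 r /\
    oroot D (Fun f us) (subst s2 r) /\ forall x, par rho (s1 x) (s2 x).
Proof.
  intros Hdef H HF.
  assert (forall t, par rho t t) as Hrefl by apply par_refl.
  inversion H as [? k r ? Hin Hl|? k r0 r1 ts' Hin Hl|? k r0 r1 t ts' Hin Hl]; subst.
  - exists (Plain (length ts) r), r, (asg ts), (asg us). repeat split; simpl; auto.
    + eapply or_plain; eauto. symmetry. eapply Forall2_length; eauto.
    + apply Forall2_asg; auto.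
  - inversion HF as [|? z ? us' Hz HF']; subst.
    apply (par_zero _ Hdef) in Hz as ->.
    exists (Case (length ts') r0 r1), r0, (asg (zero :: ts')), (asg (zero :: us')).
    repeat split; simpl; auto.
    + eapply or_zero; eauto. symmetry. eapply Forall2_length; eauto.
    + apply Forall2_asg; auto.
  - inversion HF as [|? z ? us' Hz HF']; subst.
    apply (par_succ _ Hdef) in Hz as (t' & -> & Ht).
    exists (Case (length ts') r0 r1), r1, (asg (t :: ts')), (asg (t' :: us')).
    repeat split; simpl; auto.
    + eapply or_succ; eauto. symmetry. eapply Forall2_length; eauto.
    + apply Forall2_asg; auto.
Qed.

(** Overlaps between a program step and a parallel step are reduced to the root: a [rho] redex has
    to survive program steps in its arguments, and a term that is a redex of both kinds has to
    close. All other positions follow by induction on the term. *)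
Lemma program_commute rho :
  defined rho ->
  (forall f ts us u, rho (Fun f ts) u -> Forall2 (star O) ts us ->
     exists v, rho (Fun f us) v /\ star O u v) ->
  (forall f ts us s u, oroot D (Fun f ts) s -> Forall2 (par rho) ts us ->
     rho (Fun f us) u -> exists w, par rho s w /\ star O u w) ->
  commute (star O) (par rho).
Proof.
  intros Hdef H2 H3. apply commute_rt_l.
  induction t as [x|f ts IH] using term_ind'; intros s u Hs Hu.
  { inversion Hs as [? ? Hr|]; subst. inversion Hr. }
  inversion Hs as [? ? Hr|g l1 a b l2 Hab]; subst.
  - inversion Hu as [|? ? us Hus|? ? us ? Hus Hru]; subst; eauto.
    destruct (oroot_par _ _ _ _ _ Hdef Hr Hus) as (d & r & s1 & s2 & _ & _ & -> & Hv & Hs12).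
    exists (subst s2 r). split; auto using par_subst. apply rt_step. now constructor.
  - assert (forall us, Forall2 (par rho) (l1 ++ a :: l2) us ->
      exists ws, Forall2 (par rho) (l1 ++ b :: l2) ws /\ Forall2 (star O) us ws) as Hargs.
    { intros us Hus. apply Forall2_app_inv_l in Hus as (us1 & us2 & Hus1 & Hus2 & ->).
      inversion Hus2 as [|? a' ? us2' Ha Hus2']; subst.
      apply Forall_app in IH as [_ IH]. inversion IH; subst.
      destruct (H1 _ _ Hab Ha) as (w & Hbw & Haw).
      exists (us1 ++ w :: us2'). split; apply Forall2_app; auto.
      - clear. induction us1; auto using rt_refl.
      - constructor; auto. clear. induction us2'; auto using rt_refl. }
    inversion Hu as [|? ? us Hus|? ? us ? Hus Hru]; subst;
      destruct (Hargs _ Hus) as (ws & Hw1 & Hw2).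
    + exists (Fun f ws). split; [now constructor|now apply star_args].
    + destruct (H2 _ _ _ _ Hru Hw2) as (v & Hv & Huv).
      exists v. split; auto. now apply par_root with ws.
Qed.

(** With [oroot D] itself as [rho], determinism of root steps closes the overlap. Parallel steps lie
    between single steps and many steps, so commuting with them gives confluence. *)
Lemma program_confluent : commute (star O) (star O).
Proof.
  assert (commute (star O) (par (oroot D))) as H.
  { apply program_commute; eauto using oroot_defined, oroot_star.
    intros f ts us s u Hs Hus Hu.
    destruct (oroot_par _ _ _ _ _ oroot_defined Hs Hus)
      as (d & r & s1 & s2 & _ & _ & -> & Hv & Hs12).
    rewrite (oroot_det _ _ _ Hu Hv). eauto using rt_refl, par_subst. }
  apply commute_rt_l. intros t s u Ht Hu.
  apply commute_sym in H.
  assert (par (oroot D) t s) as Hp by (apply par_of_ctx; auto using oroot_defined).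
  destruct (H _ _ _ Hp Hu) as (w & Hw & Huw).
  exists w. split; auto. apply star_of_par; auto using oroot_defined.
Qed.

Lemma star_O_num t k u : star O t (num k) -> star O t u -> star O u (num k).
Proof.
  intros H1 H2. destruct (program_confluent _ _ _ H1 H2) as (w & Hw & Huw).
  apply (star_num _ oroot_defined) in Hw as ->. exact Huw.
Qed.
End Program.

(** * The zipper rules *)

Notation Zip x a := (Fun 2 [x; a]).
Notation Done := (Fun 3 []).
Notation Run x := (Fun 4 [x]).
Notation Search u y x := (Fun 5 [u; y; x]).

Lemma succs_num i j : succs i (num j) = num (i + j).
Proof. symmetry. apply succs_add. Qed.

Lemma succs_eq k x k' x' : succs k x = succs k' x' ->
  exists j, (k = k' + j /\ x' = succs j x) \/ (k' = k + j /\ x = succs j x').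
Proof.
  intros H. destruct (Nat.le_ge_cases k k') as [Hk|Hk].
  - exists (k' - k). right. split; [lia|]. apply (succs_inj k).
    rewrite <- succs_add, H. f_equal. lia.
  - exists (k - k'). left. split; [lia|]. apply (succs_inj k').
    rewrite <- succs_add, <- H. f_equal. lia.
Qed.

Lemma num_eq_succs i k x : num i = succs k x -> exists j, x = num j /\ i = k + j.
Proof.
  revert i. induction k as [|k IH]; intros i H.
  - exists i. auto.
  - destruct i as [|i]; [discriminate|]. injection H as H.
    apply IH in H as (j & -> & ->). eauto.
Qed.

(** Moving any number of successors at once makes the relation transitive. It is also symmetric, so
    two shifts of one term differ by a single shift. *)
Inductive shift : relation term :=
| shift_l k x a : shift (Zip (succs k x) a) (Zip x (succs k a))
| shift_r k x a : shift (Zip x (succs k a)) (Zip (succs k x) a).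

Lemma shift_sym t u : shift t u -> shift u t.
Proof. destruct 1; constructor. Qed.

Lemma shift_trans t u v : shift t u -> shift u v -> shift t v.
Proof.
  intros H1 H2. destruct H1 as [k x a|k x a].
  - remember (Zip x (succs k a)) as u eqn:Eu.
    destruct H2 as [j y b|j y b]; injection Eu as E1 E2; subst.
    + rewrite <- !succs_add, (Nat.add_comm j k). constructor.
    + apply succs_eq in E2 as (i & [[-> ->]|[-> ->]]).
      * rewrite (Nat.add_comm k i), succs_add. apply shift_r.
      * rewrite (Nat.add_comm j i), succs_add. apply shift_l.
  - remember (Zip (succs k x) a) as u eqn:Eu.
    destruct H2 as [j y b|j y b]; injection Eu as E1 E2; subst.
    + apply succs_eq in E1 as (i & [[-> ->]|[-> ->]]).
      * rewrite (Nat.add_comm k i), succs_add. apply shift_l.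
      * rewrite (Nat.add_comm j i), succs_add. apply shift_r.
    + rewrite <- !succs_add, (Nat.add_comm j k). constructor.
Qed.

(** All shifts needed to reach an exit are included in the exit step. Hence the same exit remains
    one step away after any shift ([stop_shift]). *)
Inductive stop : relation term :=
| stop_run k a : stop (Zip (num k) a) (Run (succs k a))
| stop_done k x : stop (Zip x (num k)) Done.

Lemma stop_shift t u v : stop t u -> shift t v -> stop v u.
Proof.
  intros H1 H2. destruct H1 as [i a|i x].
  - remember (Zip (num i) a) as t eqn:Et.
    destruct H2 as [k y b|k y b]; injection Et as E1 E2; subst.
    + symmetry in E1. apply num_eq_succs in E1 as (j & -> & ->).
      rewrite Nat.add_comm, succs_add. constructor.
    + rewrite succs_num, <- succs_add, Nat.add_comm. constructor.
  - remember (Zip x (num i)) as t eqn:Et.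
    destruct H2 as [k y b|k y b]; injection Et as E1 E2; subst.
    + rewrite succs_num. constructor.
    + symmetry in E2. apply num_eq_succs in E2 as (j & -> & ->). constructor.
Qed.

Section Zipper.
Variable D : program.
Hypothesis Dfun : forall f d d', In (f, d) D -> In (f, d') D -> d = d'.
Hypothesis Dname : forall f d, In (f, d) D -> 3 < f.
Hypothesis Dsearch : forall f d r, In (f, d) D -> f = 4 \/ f = 5 -> In r (def_rhs d) ->
  r = Done \/ exists rs, r = Fun 5 rs.

Notation O := (ctx (oroot D)).

(* [zip_search] is not a rewrite rule: it contracts a successful search in one step, so
   that the peak between [Run (num n)] and [Done] can be closed by a single step. *)
Inductive zip : relation term :=
| zip_shift t u : shift t u -> zip t u
| zip_stop t u : stop t u -> zip t u
| zip_search f ts : f = 4 \/ f = 5 -> star O (Fun f ts) Done -> zip (Fun f ts) Done.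

Lemma zip_defined : defined zip.
Proof.
  intros t u [? ? []|? ? []|? ? [|]]; subst; eexists _, _; split; eauto; lia.
Qed.

Lemma star_Done u : star O Done u -> u = Done.
Proof.
  intros H. apply clos_rt_rt1n in H. destruct H as [|w u H _]; auto.
  exfalso. inversion H as [? ? Hr|? l1 ? ? l2]; subst.
  - apply (oroot_name _ Dname) in Hr. lia.
  - destruct l1; discriminate.
Qed.

Lemma par_Done u : par zip Done u -> u = Done.
Proof.
  inversion 1 as [|? ? us Hus|? ? us ? Hus Hr]; subst; inversion Hus; subst; auto.
  inversion Hr as [? ? Hs|? ? Hs|f ts Hf]; subst; try (inversion Hs; fail). auto.
Qed.

Lemma Forall2_2 {X} (Q : X -> X -> Prop) a b l :
  Forall2 Q [a; b] l -> exists c d, l = [c; d] /\ Q a c /\ Q b d.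
Proof.
  intros H. inversion H as [|? c ? l' Hc H']; subst.
  inversion H' as [|? d ? l'' Hd H'']; subst. inversion H''; subst. eauto 6.
Qed.

Lemma zip_star f ts us u :
  zip (Fun f ts) u -> Forall2 (star O) ts us ->
  exists v, zip (Fun f us) v /\ star O u v.
Proof.
  intros H HF. remember (Fun f ts) as t eqn:Et.
  pose proof (oroot_defined D Dname) as Hdef.
  assert (forall g a b c d, star O a c -> star O b d ->
            star O (Fun g [a; b]) (Fun g [c; d])) as Hbin by (intros; apply star_args; auto).
  assert (forall g a c, star O a c -> star O (Fun g [a]) (Fun g [c])) as Hun
    by (intros; apply star_args; auto).
  destruct H as [t u [k x a|k x a]|t u [k a|k x]|g gs Hg Hs]; injection Et as <- <-;
    try (apply Forall2_2 in HF as (c & d & -> & Hc & Hd)).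
  - apply (star_succs_inv _ Hdef) in Hc as (x' & -> & Hx).
    exists (Zip x' (succs k d)). split; [apply zip_shift; constructor|].
    apply Hbin; auto using star_succs.
  - apply (star_succs_inv _ Hdef) in Hd as (a' & -> & Ha).
    exists (Zip (succs k c) a'). split; [apply zip_shift; constructor|].
    apply Hbin; auto using star_succs.
  - apply (star_num _ Hdef) in Hc as ->.
    exists (Run (succs k d)). split; [apply zip_stop; constructor|].
    apply Hun; auto using star_succs.
  - apply (star_num _ Hdef) in Hd as ->.
    exists Done. split; [apply zip_stop; constructor|apply rt_refl].
  - exists Done. split; [|apply rt_refl]. apply zip_search; auto.
    (* [Done] is a normal form and the program is confluent, so a search that can succeed still can
       after its arguments are reduced. *)
    apply star_args with (f := g) in HF.
    destruct (program_confluent D Dfun Dname _ _ _ Hs HF) as (w & Hw & Hgw).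
    apply star_Done in Hw as ->. exact Hgw.
Qed.

(** The only overlap at the root is a program step against [zip_search]. By [Dsearch] the program
    step yields [Done] or another search, and by confluence of the program that search still
    succeeds. *)
Lemma zip_program_commute : commute (star O) (par zip).
Proof.
  apply program_commute; auto using zip_defined; [apply zip_star|].
  intros f ts us s u Hs Hus Hu.
  pose proof (oroot_name _ Dname _ _ _ Hs) as Hf.
  destruct (oroot_par D _ _ _ _ _ zip_defined Hs Hus)
    as (d & r & s1 & s2 & Hd & Hr & -> & Hv & Hs12).
  remember (Fun f us) as t eqn:Et.
  destruct Hu as [t u []|t u []|g gs Hg Hdone]; injection Et as <- <-; try lia.
  exists Done. split; [|apply rt_refl].
  destruct (Dsearch _ _ _ Hd Hg Hr) as [->|[rs ->]].
  - apply par_refl.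
  (* The new search reduces its arguments in parallel and is then contracted at the root, all within
     one parallel step. *)
  - simpl. apply par_root with (map (subst s2) rs).
    + clear -Hs12. induction rs; simpl; auto using par_subst.
    + apply zip_search; auto.
      assert (star O (Fun g gs) (subst s2 (Fun 5 rs))) as Hstep
        by (apply rt_step; now constructor).
      destruct (program_confluent D Dfun Dname _ _ _ Hdone Hstep) as (w & Hw & Hgw).
      apply star_Done in Hw as ->. exact Hgw.
Qed.

(** Contracting before and after the parallel steps yields the same root symbol with related
    arguments. This is stronger than a parallel step between the two results: a further contraction
    at the root can still be appended, as [par_then] does. *)
Lemma zip_par f us us' u :
  zip (Fun f us) u -> Forall2 (par zip) us us' ->
  exists g ss ss', u = Fun g ss /\ zip (Fun f us') (Fun g ss') /\
    Forall2 (par zip) ss ss'.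
Proof.
  intros H HF. remember (Fun f us) as t eqn:Et.
  pose proof zip_defined as Hdef.
  destruct H as [t u [k x a|k x a]|t u [k a|k x]|g gs Hg Hs]; injection Et as <- <-;
    try (apply Forall2_2 in HF as (c & d & -> & Hc & Hd)).
  - apply (par_succs _ Hdef) in Hc as (x' & -> & Hx).
    eexists _, _, [x'; succs k d]. split; [reflexivity|].
    split; [apply zip_shift; constructor|]. auto using succs_par.
  - apply (par_succs _ Hdef) in Hd as (a' & -> & Ha).
    eexists _, _, [succs k c; a']. split; [reflexivity|].
    split; [apply zip_shift; constructor|]. auto using succs_par.
  - apply (par_num _ Hdef) in Hc as ->.
    eexists _, _, [succs k d]. split; [reflexivity|].
    split; [apply zip_stop; constructor|]. auto using succs_par.
  - apply (par_num _ Hdef) in Hd as ->.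
    exists 3, [], []. split; [reflexivity|]. split; [apply zip_stop; constructor|]. auto.
  - exists 3, [], []. split; [reflexivity|]. split; [|constructor].
    apply zip_search; auto.
    (* Parallel [zip] steps commute with the program and leave [Done] fixed, so they preserve
       success of the search. *)
    assert (par zip (Fun g gs) (Fun g us')) as Hp by now constructor.
    destruct (zip_program_commute _ _ _ Hs Hp) as (w & Hw & Hgw).
    apply par_Done in Hw as ->. exact Hgw.
Qed.

Section Halting.
Hypothesis halts : forall n, star O (Run (num n)) Done.

Lemma zip_peak t u v : zip t u -> zip t v ->
  exists w, (u = w \/ zip u w) /\ (v = w \/ zip v w).
Proof.
  assert (forall t f ts u, t = Fun f ts -> f = 4 \/ f = 5 ->
            shift t u \/ stop t u -> False) as Hno.
  { intros t' f ts u' Et Hf [H|H]; destruct H; injection Et as E _; lia. }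
  intros H1 H2.
  destruct H1 as [t u H1|t u H1|f ts Hf H1]; inversion H2 as [? ? H3|? ? H3|g gs Hg H3]; subst;
    try (exfalso; eapply Hno; eauto; fail).
  - exists u. split; auto. right. apply zip_shift.
    eapply shift_trans; eauto using shift_sym.
  - exists v. split; auto. right. apply zip_stop. eapply stop_shift; eauto.
  - exists u. split; auto. right. apply zip_stop. eapply stop_shift; eauto.
  (* Two exits differ only if both arguments are numerals. Then [Run] is applied to a numeral, and
     [halts] turns its whole search into one [zip] step. *)
  - assert (forall n, zip (Run (num n)) Done) as Hrun by (intros; apply zip_search; auto).
    destruct H1 as [i a|i x]; inversion H3 as [j b E1|j y E1 E2]; subst.
    + apply num_inj in E1 as ->. eauto.
    + exists Done. rewrite succs_num. auto.
    + exists Done. rewrite succs_num. auto.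
    + exists Done. auto.
  - exists Done. auto.
Qed.

(** Closing a root peak may contract the root of a contractum whose arguments also still move; both
    fit into a single parallel step. *)
Lemma par_then f ss ss' w :
  Forall2 (par zip) ss ss' -> (Fun f ss' = w \/ zip (Fun f ss') w) ->
  par zip (Fun f ss) w.
Proof. intros H [<-|Hw]; [now constructor|now apply par_root with ss']. Qed.

Lemma zip_diamond : commute (par zip) (par zip).
Proof.
  intros t. induction t as [x|f ts IH] using term_ind'; intros u v Hu Hv.
  { inversion Hu; inversion Hv; subst. eauto. }
  assert (forall us vs, Forall2 (par zip) ts us -> Forall2 (par zip) ts vs ->
            exists ws, Forall2 (par zip) us ws /\ Forall2 (par zip) vs ws) as Hargs.
  { clear -IH. induction IH as [|t ts Ht _ IH]; intros us vs Hus Hvs;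
      inversion Hus; inversion Hvs; subst; eauto.
    match goal with H1 : par zip t _, H2 : par zip t _, H3 : Forall2 _ ts _,
                    H4 : Forall2 _ ts _ |- _ =>
      destruct (Ht _ _ H1 H2) as (w & ? & ?); destruct (IH _ _ H3 H4) as (ws & ? & ?) end.
    exists (w :: ws). auto. }
  inversion Hu as [|? ? us Hus|? ? us ? Hus Hru]; subst;
    inversion Hv as [|? ? vs Hvs|? ? vs ? Hvs Hrv]; subst;
    destruct (Hargs _ _ Hus Hvs) as (ws & Huw & Hvw).
  - exists (Fun f ws). split; now constructor.
  - destruct (zip_par _ _ _ _ Hrv Hvw) as (g & ss & ss' & -> & Hz & Hss).
    exists (Fun g ss'). split; [now apply par_root with ws|now constructor].
  - destruct (zip_par _ _ _ _ Hru Huw) as (g & ss & ss' & -> & Hz & Hss).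
    exists (Fun g ss'). split; [now constructor|now apply par_root with ws].
  - destruct (zip_par _ _ _ _ Hru Huw) as (g1 & ss1 & ss1' & -> & Hz1 & Hss1).
    destruct (zip_par _ _ _ _ Hrv Hvw) as (g2 & ss2 & ss2' & -> & Hz2 & Hss2).
    destruct (zip_peak _ _ _ Hz1 Hz2) as (w & Hw1 & Hw2).
    exists w. eauto using par_then.
Qed.

Lemma zip_union_confluent :
  commute (star (union term (star O) (par zip))) (star (union term (star O) (par zip))).
Proof.
  apply union_confluent; auto using rt_refl, par_refl, zip_diamond, zip_program_commute.
  now apply program_confluent.
Qed.
End Halting.
End Zipper.

(** * Programs computing recursive functions *)

Fixpoint rf_ind' (Q : rf -> Prop) (H0 : Q RZero) (HS : Q RSucc)
  (HP : forall i, Q (RProj i))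
  (HC : forall f gs, Q f -> Forall Q gs -> Q (RComp f gs))
  (HR : forall f g, Q f -> Q g -> Q (RPrec f g))
  (HM : forall f, Q f -> Q (RMin f)) (p : rf) : Q p :=
  let rec := rf_ind' Q H0 HS HP HC HR HM in
  match p with
  | RZero => H0
  | RSucc => HS
  | RProj i => HP i
  | RComp f gs => HC f gs (rec f) ((fix go l : Forall Q l :=
      match l with
      | [] => Forall_nil _
      | g :: l' => Forall_cons g (rec g) (go l')
      end) gs)
  | RPrec f g => HR f g (rec f) (rec g)
  | RMin f => HM f (rec f)
  end.

Fixpoint encrf (p : rf) : nat :=
  match p with
  | RZero => pr 0 0
  | RSucc => pr 1 0
  | RProj i => pr 2 i
  | RComp f gs => pr 3 (pr (encrf f) (encl (map encrf gs)))
  | RPrec f g => pr 4 (pr (encrf f) (encrf g))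
  | RMin f => pr 5 (encrf f)
  end.

Lemma pr_inj a b c d : pr a b = pr c d -> a = c /\ b = d.
Proof.
  intros H. apply (f_equal of_nat) in H. unfold pr in H. rewrite !cancel_of_to in H.
  injection H. auto.
Qed.

Lemma encl_inj l l' : encl l = encl l' -> l = l'.
Proof. intros H. rewrite <- (dl_encl l), H. apply dl_encl. Qed.

Lemma encrf_inj p q : encrf p = encrf q -> p = q.
Proof.
  revert q. induction p as [| |i|f gs IHf IHgs|f g IHf IHg|f IHf] using rf_ind';
    intros [| |j|f' gs'|f' g'|f'] H; simpl in H; apply pr_inj in H as [Ht H];
    try discriminate Ht; try (apply pr_inj in H as [H1 H2]); f_equal; auto.
  apply encl_inj in H2. clear -IHgs H2. revert gs' H2.
  induction IHgs as [|g gs Hg _ IH]; intros [|g' gs'] H; try discriminate; auto.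
  injection H as H1 H2. f_equal; auto.
Qed.

(** A program accepts argument lists of any length, while a symbol has one definition of fixed
    arity, so the arity is part of the name. The offset 7 skips the reserved symbols 0 to 6. *)
Definition fun_name (p : rf) (k : nat) : nat := 7 + pr 0 (pr k (encrf p)).
Definition loop_name (p : rf) (k : nat) : nat := 7 + pr 1 (pr k (encrf p)).

Lemma fun_name_inj p k q j : fun_name p k = fun_name q j -> p = q /\ k = j.
Proof.
  intros H. apply Nat.add_cancel_l, pr_inj in H as [_ H].
  apply pr_inj in H as [-> H]. apply encrf_inj in H. auto.
Qed.

Lemma loop_name_inj p k q j : loop_name p k = loop_name q j -> p = q /\ k = j.
Proof.
  intros H. apply Nat.add_cancel_l, pr_inj in H as [_ H].
  apply pr_inj in H as [-> H]. apply encrf_inj in H. auto.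
Qed.

Lemma fun_name_loop_nm p k q j : fun_name p k <> loop_name q j.
Proof. intros H. apply Nat.add_cancel_l, pr_inj in H as [H _]. discriminate. Qed.

Definition var_args (a k : nat) : list term := map Var (seq a k).

(** [None] marks the arities at which no rule of [eval] applies to the program. *)
Definition main_def (p : rf) (k : nat) : option def :=
  match p with
  | RZero => Some (Plain k zero)
  | RSucc => match k with 0 => None | S _ => Some (Plain k (succ (Var 0))) end
  | RProj i => if i <? k then Some (Plain k (Var i)) else None
  | RComp f gs => Some (Plain k
      (Fun (fun_name f (length gs)) (map (fun g => Fun (fun_name g k) (var_args 0 k)) gs)))
  | RPrec f g =>
      match k with
      | 0 => None
      | S j => Some (Case j (Fun (fun_name f j) (var_args 1 j))
          (Fun (fun_name g (S k))
             (Var 0 :: Fun (fun_name p k) (var_args 0 k) :: var_args 1 j)))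
      end
  | RMin f => Some (Plain k
      (Fun (loop_name f k)
         (Fun (fun_name f (S k)) (zero :: var_args 0 k) :: zero :: var_args 0 k)))
  end.

(** The first argument holds the value of [f] at the candidate in [Var 1]; the parameters start at
    [Var 2]. At value zero the candidate is returned, otherwise its successor is tried. *)
Definition loop_def (f : rf) (k : nat) : def :=
  Case (S k) (Var 1)
    (Fun (loop_name f k)
       (Fun (fun_name f (S k)) (succ (Var 1) :: var_args 2 k)
          :: succ (Var 1) :: var_args 2 k)).

Definition own_defs (p : rf) (k : nat) : program :=
  match main_def p k with Some d => [(fun_name p k, d)] | None => [] end ++
  match p with RMin f => [(loop_name f k, loop_def f k)] | _ => [] end.

Fixpoint all_defs (p : rf) (k : nat) : program :=
  own_defs p k ++
  match p with
  | RComp f gs => all_defs f (length gs) ++ flat_map (fun g => all_defs g k) gs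
  | RPrec f g => all_defs f (pred k) ++ all_defs g (S k)
  | RMin f => all_defs f (S k)
  | _ => []
  end.

Lemma in_all_defs p k fd :
  In fd (all_defs p k) -> exists q j, In fd (own_defs q j).
Proof.
  revert k. induction p as [| |i|f gs IHf IHgs|f g IHf IHg|f IHf] using rf_ind';
    intros k H; cbn [all_defs] in H; apply in_app_or in H as [H|H]; eauto;
    try (destruct H; fail).
  - apply in_app_or in H as [H|H]; eauto.
    apply in_flat_map in H as (g & Hg & H). rewrite Forall_forall in IHgs. eauto.
  - apply in_app_or in H as [H|H]; eauto.
Qed.

Lemma in_own_defs f d q j : In (f, d) (own_defs q j) ->
  (f = fun_name q j /\ main_def q j = Some d) \/
  (exists b, f = loop_name b j /\ d = loop_def b j).
Proof.
  unfold own_defs. intros [H|H]%in_app_or.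
  - destruct (main_def q j); [|destruct H]. destruct H as [H|[]].
    injection H as -> ->. auto.
  - destruct q; try (destruct H; fail). destruct H as [H|[]].
    injection H as <- <-. eauto.
Qed.

(** A name determines its program and arity, so a subprogram that occurs repeatedly contributes the
    same definition each time. *)
Lemma own_defs_fun f d d' q j q' j' :
  In (f, d) (own_defs q j) -> In (f, d') (own_defs q' j') -> d = d'.
Proof.
  intros [[-> H]|(b & -> & ->)]%in_own_defs [[E H']|(b' & E & ->)]%in_own_defs.
  - apply fun_name_inj in E as [-> ->]. congruence.
  - now apply fun_name_loop_nm in E.
  - symmetry in E. now apply fun_name_loop_nm in E.
  - apply loop_name_inj in E as [-> ->]. reflexivity.
Qed.

Lemma own_defs_name f d q j : In (f, d) (own_defs q j) -> 7 <= f.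
Proof.
  intros [[-> _]|(b & -> & _)]%in_own_defs; apply Nat.le_add_r.
Qed.

(** * Variable condition and terms without [Zip] *)

Definition closed_rules (D : program) : Prop :=
  forall fd l r, In fd D -> In (l, r) (def_rules fd) -> incl (vars r) (vars l).

(** Such terms take program steps only ([no_zip_step]), so the reducts of [Run (num x)] can be
    followed inside the program. *)
Inductive no_zip : term -> Prop :=
| no_zip_var x : no_zip (Var x)
| no_zip_fun f ts : f <> 2 -> Forall no_zip ts -> no_zip (Fun f ts).

Definition zip_free (D : program) : Prop :=
  forall f d r, In (f, d) D -> In r (def_rhs d) -> no_zip r.

Lemma varsl_vs a k : varsl (var_args a k) = seq a k.
Proof.
  unfold var_args. induction (seq a k) as [|x l IH]; simpl; congruence.
Qed.

Lemma no_zip_vs a k : Forall no_zip (var_args a k).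
Proof. apply Forall_map, Forall_forall. constructor. Qed.

Lemma varsl_calls k gs :
  incl (varsl (map (fun g => Fun (fun_name g k) (var_args 0 k)) gs)) (seq 0 k).
Proof.
  induction gs as [|g gs IH].
  - intros x [].
  - unfold varsl in *. cbn [map flat_map]. rewrite vars_fun, varsl_vs.
    apply incl_app; auto using incl_refl.
Qed.

Lemma varsl_cons t ts : varsl (t :: ts) = vars t ++ varsl ts.
Proof. reflexivity. Qed.

Lemma own_defs_closed q j : closed_rules (own_defs q j).
Proof.
  assert (forall i, vars (Var i) = [i]) as Hvar by reflexivity.
  assert (forall t, vars (succ t) = vars t) as Hsucc.
  { intros t. unfold succ. rewrite vars_fun, varsl_cons.
    apply app_nil_r. }
  assert (vars zero = []) as Hzero by reflexivity.
  intros [f d] l r H Hlr. apply in_own_defs in H as [[-> H]|(b & -> & ->)].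
  - pose proof (varsl_calls j) as Hcalls.
    destruct q as [| |i|h gs|h g|h]; cbn [main_def] in H;
      [|destruct j as [|j]|destruct (Nat.ltb_spec i j)| |destruct j as [|j]|];
      try discriminate; injection H as <-; cbn [def_rules] in Hlr;
      repeat (destruct Hlr as [Hlr|Hlr]; [injection Hlr as <- <-|]);
      try (destruct Hlr; fail); fold (var_args 0 j) (var_args 1 j) (var_args 0 (S j)); intros x;
      repeat rewrite ?vars_fun, ?varsl_cons, ?Hvar, ?Hsucc, ?Hzero, ?varsl_vs,
        ?in_app_iff, ?in_seq; simpl In; try lia.
    intros Hx. apply Hcalls, in_seq in Hx. lia.
  - cbn [loop_def def_rules] in Hlr. fold (var_args 1 (S j)) in Hlr.
    repeat (destruct Hlr as [Hlr|Hlr]; [injection Hlr as <- <-|]);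
      try (destruct Hlr; fail); intros x;
      repeat rewrite ?vars_fun, ?varsl_cons, ?Hvar, ?Hsucc, ?Hzero, ?varsl_vs,
        ?in_app_iff, ?in_seq; simpl In; lia.
Qed.

Lemma own_defs_zip_free q j : zip_free (own_defs q j).
Proof.
  assert (forall p k, fun_name p k <> 2) as Hnm by discriminate.
  assert (forall p k, loop_name p k <> 2) as Hloop by discriminate.
  assert (no_zip zero) as Hzero by (constructor; auto).
  assert (forall t, no_zip t -> no_zip (succ t)) as Hsucc by (constructor; auto).
  assert (forall i, no_zip (Var i)) as Hvar by constructor.
  intros f d r H Hr. apply in_own_defs in H as [[-> H]|(b & -> & ->)].
  - destruct q as [| |i|h gs|h g|h]; cbn [main_def] in H;
      [|destruct j as [|j]|destruct (Nat.ltb_spec i j)| |destruct j as [|j]|];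
      try discriminate; injection H as <-; cbn [def_rhs] in Hr;
      repeat (destruct Hr as [<-|Hr]); try (destruct Hr; fail);
      repeat (apply Hnm || apply Hloop || apply no_zip_vs || discriminate || constructor).
    apply Forall_map, Forall_forall. constructor; auto using no_zip_vs.
  - cbn [loop_def def_rhs] in Hr.
    repeat (destruct Hr as [<-|Hr]); try (destruct Hr; fail);
      repeat (apply Hnm || apply Hloop || apply no_zip_vs || discriminate || constructor).
Qed.

(** * The rewriting system that searches for a witness *)

Definition nums (v : list nat) : list term := map num v.

Lemma length_nums v : length (nums v) = length v.
Proof. apply length_map. Qed.

Lemma map_asg_vs pre ts :
  map (subst (asg (pre ++ ts))) (var_args (length pre) (length ts)) = ts.
Proof.
  unfold var_args. rewrite map_map. simpl. revert pre.
  induction ts as [|t ts IH]; intros pre; simpl; auto. f_equal.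
  - unfold asg. rewrite app_nth2, Nat.sub_diag; auto.
  - specialize (IH (pre ++ [t])). rewrite length_app, Nat.add_1_r, <- app_assoc in IH.
    exact IH.
Qed.

Section Simulation.
Variable D : program.
Notation O := (ctx (oroot D)).

Lemma step_plain f k r ts :
  In (f, Plain k r) D -> length ts = k -> star O (Fun f ts) (subst (asg ts) r).
Proof. intros. apply rt_step, ctx_root. eapply or_plain; eauto. Qed.

Lemma step_zero f k r0 r1 ts :
  In (f, Case k r0 r1) D -> length ts = k ->
  star O (Fun f (zero :: ts)) (subst (asg (zero :: ts)) r0).
Proof. intros. apply rt_step, ctx_root. eapply or_zero; eauto. Qed.

Lemma step_succ f k r0 r1 t ts :
  In (f, Case k r0 r1) D -> length ts = k ->
  star O (Fun f (succ t :: ts)) (subst (asg (t :: ts)) r1).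
Proof. intros. apply rt_step, ctx_root. eapply or_succ; eauto. Qed.

Lemma Forall2_star_refl ts : Forall2 (star O) ts ts.
Proof. induction ts; auto using rt_refl. Qed.

(** Numerals are normal forms, so together with confluence of the program this fixes the value:
    every reduct of the call still reduces to [num y] ([star_O_num]). *)
Lemma eval_star p k v y :
  incl (all_defs p k) D -> length v = k -> eval p v y ->
  star O (Fun (fun_name p k) (nums v)) (num y).
Proof.
  revert k v y.
  induction p as [| |i|f gs IHf IHgs|f g IHf IHg|f IHf] using rf_ind';
    intros k v y HD Hk He; cbn [all_defs own_defs] in HD.
  - inversion He; subst.
    apply (step_plain _ (length v) zero); [apply HD; simpl; auto|].
    apply length_nums.
  - inversion He as [|x v'| | | | |]; subst. simpl in *.
    eapply rt_trans; [eapply (step_plain _ (S (length v')) (succ (Var 0)))|].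
    + apply HD. simpl. auto.
    + apply (length_nums (x :: v')).
    + apply rt_refl.
  - inversion He as [| |i' v' Hi| | | |]; subst.
    eapply rt_trans; [eapply (step_plain _ (length v) (Var i))|].
    + apply HD. unfold own_defs. simpl. destruct (Nat.ltb_spec i (length v)); [|lia].
      simpl. auto.
    + apply length_nums.
    (* The default [zero] of [asg] is the numeral of the default [0] in the rule for projections. *)
    + simpl. unfold asg, nums. change zero with (num 0). rewrite map_nth. apply rt_refl.
  - inversion He as [| | |? ? ? ws ? Hws Hf| | |]; subst.
    apply incl_app_inv in HD as [Hown HD]. apply incl_app_inv in HD as [HDf HDgs].
    assert (length ws = length gs) as Hlen by (symmetry; eapply Forall2_length; eauto).
    eapply rt_trans; [eapply (step_plain _ (length v))|].
    + apply Hown. simpl. eauto.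
    + apply length_nums.
    + simpl. rewrite map_map. simpl.
      apply rt_trans with (Fun (fun_name f (length gs)) (nums ws)); [apply star_args|eauto].
      assert (map (subst (asg (nums v))) (var_args 0 (length v)) = nums v) as ->.
      { rewrite <- (length_map num v) at 1. apply (map_asg_vs []). }
      clear -IHgs Hws HDgs. induction Hws as [|g w gs ws Hgw _ IH]; simpl; auto.
      inversion IHgs; subst. simpl in HDgs. apply incl_app_inv in HDgs as [H3 H4].
      constructor; auto.
  - apply incl_app_inv in HD as [Hown HD]. apply incl_app_inv in HD as [HDf HDg].
    destruct v as [|n v]; [inversion He|]. simpl in Hk. subst k. simpl in HDf.
    assert (In (fun_name (RPrec f g) (S (length v)),
                Case (length v) (Fun (fun_name f (length v)) (var_args 1 (length v)))
                  (Fun (fun_name g (S (S (length v))))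
                     (Var 0 :: Fun (fun_name (RPrec f g) (S (length v))) (var_args 0 (S (length v)))
                            :: var_args 1 (length v)))) D) as Hin
      by (apply Hown; simpl; auto).
    assert (forall t, map (subst (asg (t :: nums v))) (var_args 1 (length v)) = nums v) as Hvs.
    { intros t. rewrite <- (length_map num v) at 1. apply (map_asg_vs [t]). }
    revert y He. induction n as [|n IHn]; intros y He.
    + inversion He; subst. eapply rt_trans; [eapply (step_zero _ _ _ _ (nums v)); eauto|].
      * apply length_nums.
      * simpl. rewrite Hvs. auto.
    + inversion He as [| | | | |? ? ? ? z ? Hz Hg|]; subst.
      eapply rt_trans; [eapply (step_succ _ _ _ _ (num n) (nums v)); eauto|].
      * apply length_nums.
      * cbn [subst map]. rewrite Hvs.
        assert (map (subst (asg (num n :: nums v))) (var_args 0 (S (length v)))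
                = nums (n :: v)) as ->.
        { rewrite <- (length_nums v) at 1. apply (map_asg_vs [] (num n :: nums v)). }
        apply rt_trans with (Fun (fun_name g (S (S (length v)))) (nums (n :: z :: v))).
        -- apply star_args. constructor; [apply rt_refl|].
           constructor; [apply IHn, Hz|apply Forall2_star_refl].
        -- apply IHg; auto.
  - apply incl_app_inv in HD as [Hown HDf].
    inversion He as [| | | | | |? ? ? Hn Hlt]; subst.
    set (k := length v) in *.
    assert (length (nums v) = k) as Hk by apply length_map.
    assert (In (loop_name f k, loop_def f k) D) as Hloop by (apply Hown; simpl; auto).
    set (call m := Fun (fun_name f (S k)) (nums (m :: v))).
    (* Induction on the distance [j] from the candidate [m] to the least zero [y]; before [y] the
       value of [f] is a successor by [Hlt]. *)
    assert (forall j m, m + j = y ->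
      star O (Fun (loop_name f k) (call m :: nums (m :: v))) (num y)) as H.
    { induction j as [|j IH]; intros m Hm.
      - replace m with y by lia.
        eapply rt_trans; [apply star_args; constructor;
          [apply (IHf (S k) _ 0); simpl; auto|apply Forall2_star_refl]|].
        eapply rt_trans; [eapply step_zero; eauto; simpl; auto|]. apply rt_refl.
      - destruct (Hlt m) as [z Hz]; [lia|].
        eapply rt_trans; [apply star_args; constructor;
          [apply (IHf (S k) _ (S z)); simpl; auto|apply Forall2_star_refl]|].
        eapply rt_trans;
          [eapply (step_succ _ _ _ _ (num z) (nums (m :: v))); eauto; simpl; auto|].
        cbn [subst map succ].
        replace (map (subst (asg (num z :: nums (m :: v)))) (var_args 2 k)) with (nums v).
        + apply (IH (S m)). lia.
        + symmetry. rewrite <- Hk. apply (map_asg_vs [num z; num m]). }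
    eapply rt_trans; [eapply step_plain; [apply Hown; simpl; auto|exact Hk]|].
    cbn [subst map zero].
    replace (map (subst (asg (nums v))) (var_args 0 k)) with (nums v).
    + apply (H y 0). reflexivity.
    + symmetry. rewrite <- Hk. apply (map_asg_vs []).
Qed.
End Simulation.

(** * Root steps as instances of rewrite rules *)

Lemma subst_vars_eq s f a k : subst s (Fun f (var_args a k)) = Fun f (map s (seq a k)).
Proof. simpl. unfold var_args. rewrite map_map. reflexivity. Qed.

Lemma nth_map_seq (s : nat -> term) a k x :
  In x (seq a k) -> nth (x - a) (map s (seq a k)) zero = s x.
Proof.
  intros H%in_seq. apply nth_error_nth. rewrite nth_error_map, nth_error_seq.
  destruct (Nat.ltb_spec (x - a) k); [|lia]. simpl. do 2 f_equal. lia.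
Qed.

(** Closedness makes [s] and the assignment read off the arguments agree on the right-hand side; on
    a variable absent from the pattern they could differ. *)
Lemma rule_oroot D fd l r s :
  closed_rules D -> In fd D -> In (l, r) (def_rules fd) ->
  oroot D (subst s l) (subst s r).
Proof.
  intros Hcl Hin Hlr. specialize (Hcl _ _ _ Hin Hlr).
  destruct fd as [f [k r'|k r0 r1]]; simpl def_rules in Hlr;
    repeat (destruct Hlr as [Hlr|Hlr]; [injection Hlr as <- <-|]);
    try (destruct Hlr; fail); fold (var_args 0 k) (var_args 1 k) in *;
    rewrite vars_fun, ?varsl_cons, varsl_vs in Hcl.
  - rewrite subst_vars_eq, (subst_ext_in s (asg (map s (seq 0 k))) r').
    + eapply or_plain; eauto. now rewrite length_map, length_seq.
    + intros x Hx%Hcl. unfold asg. rewrite <- (nth_map_seq s 0 k x Hx). f_equal. lia.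
  - rewrite (subst_ext_in s (asg (zero :: map s (seq 1 k))) r0).
    + simpl. unfold var_args. rewrite map_map. eapply or_zero; eauto.
      now rewrite length_map, length_seq.
    + intros [|x] Hx%Hcl; [apply in_seq in Hx; lia|].
      rewrite <- (nth_map_seq s 1 k (S x) Hx). simpl. now rewrite Nat.sub_0_r.
  - rewrite (subst_ext_in s (asg (s 0 :: map s (seq 1 k))) r1).
    + simpl. unfold var_args. rewrite map_map. eapply or_succ; eauto.
      now rewrite length_map, length_seq.
    + intros [|x] Hx%Hcl; [reflexivity|].
      assert (In (S x) (seq 1 k)) as Hx'.
      { destruct Hx as [Hx|Hx]; [discriminate|]. auto. }
      rewrite <- (nth_map_seq s 1 k (S x) Hx'). simpl. now rewrite Nat.sub_0_r.
Qed.

Lemma oroot_rule D t u :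
  oroot D t u ->
  exists fd l r s, In fd D /\ In (l, r) (def_rules fd) /\ t = subst s l /\ u = subst s r.
Proof.
  assert (forall pre ts, map (asg (pre ++ ts)) (seq (length pre) (length ts)) = ts) as Hmap.
  { intros pre ts. rewrite <- (map_asg_vs pre ts) at 3. unfold var_args. now rewrite map_map. }
  intros H. destruct H as [f k r ts Hin <-|f k r0 r1 ts Hin <-|f k r0 r1 t ts Hin <-].
  - eexists _, _, r, (asg ts). split; [exact Hin|]. split; [simpl; auto|]. split; auto.
    fold (var_args 0 (length ts)). rewrite subst_vars_eq. f_equal. symmetry. apply (Hmap []).
  - eexists _, _, r0, (asg (zero :: ts)). split; [exact Hin|]. split; [simpl; auto|].
    split; auto. simpl. rewrite map_map. do 2 f_equal. symmetry. apply (Hmap [zero]).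
  - eexists _, _, r1, (asg (t :: ts)). split; [exact Hin|]. split; [simpl; auto|].
    split; auto. simpl. rewrite map_map. do 2 f_equal. symmetry. apply (Hmap [t]).
Qed.

(* The constant [Fun 6 []] stands for the parameter [n] of the search; its rule is the
   only one that depends on [n]. *)
Definition call (p : rf) (x y : term) : term := Fun (fun_name p 3) [Fun 6 []; x; y].

(** In this rule [Var 0] is the predecessor of the nonzero value just found, [Var 1] is the
    candidate that gave it, and [Var 2] is the argument of [Run]. *)
Definition search_next (p : rf) : term :=
  Search (call p (Var 2) (succ (Var 1))) (succ (Var 1)) (Var 2).

Definition fixed_defs (p : rf) : program :=
  (4, Plain 1 (Search (call p (Var 0) zero) zero (Var 0))) ::
  (5, Case 2 Done (search_next p)) ::
  all_defs p 3.

Definition search_defs (p : rf) (n : nat) : program :=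
  (6, Plain 0 (num n)) :: fixed_defs p.

Definition zip_rules : list (term * term) :=
  [ (Zip (succ (Var 0)) (Var 1), Zip (Var 0) (succ (Var 1)));
    (Zip (Var 0) (succ (Var 1)), Zip (succ (Var 0)) (Var 1));
    (Zip (Var 0) zero, Done);
    (Zip zero (Var 0), Run (Var 0)) ].

Definition fixed_rules (p : rf) : list (term * term) :=
  zip_rules ++ flat_map def_rules (fixed_defs p).

Definition search_rules (p : rf) (n : nat) : list (term * term) :=
  (Fun 6 [], num n) :: fixed_rules p.

Lemma in_search_rules p n l r :
  In (l, r) (search_rules p n) <->
  In (l, r) zip_rules \/ exists fd, In fd (search_defs p n) /\ In (l, r) (def_rules fd).
Proof.
  unfold search_rules, fixed_rules, search_defs.
  cbn [In]. rewrite in_app_iff, in_flat_map. split.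
  - intros [H|[H|(fd & H1 & H2)]]; eauto.
    right. exists (6, Plain 0 (num n)). rewrite <- H. simpl. auto.
  - intros [H|(fd & [<-|H1] & H2)]; eauto.
    destruct H2 as [H2|[]]. injection H2 as <- <-. auto.
Qed.

Lemma in_search_defs p n f d : In (f, d) (search_defs p n) ->
  (f = 6 /\ d = Plain 0 (num n)) \/
  (f = 4 /\ d = Plain 1 (Search (call p (Var 0) zero) zero (Var 0))) \/
  (f = 5 /\ d = Case 2 Done (search_next p)) \/
  (7 <= f /\ exists q j, In (f, d) (own_defs q j)).
Proof.
  intros [H|[H|[H|H]]]; try (injection H as <- <-; auto; fail).
  right. right. right. apply in_all_defs in H as (q & j & H).
  split; eauto. eapply own_defs_name; eauto.
Qed.

Lemma search_defs_fun p n f d d' :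
  In (f, d) (search_defs p n) -> In (f, d') (search_defs p n) -> d = d'.
Proof.
  intros [[-> ->]|[[-> ->]|[[-> ->]|(H & q & j & Hd)]]]%in_search_defs
    [[E ->]|[[E ->]|[[E ->]|(H' & q' & j' & Hd')]]]%in_search_defs; try lia; auto.
  eapply own_defs_fun; eauto.
Qed.

Lemma search_defs_name p n f d : In (f, d) (search_defs p n) -> 3 < f.
Proof.
  intros [[-> ->]|[[-> ->]|[[-> ->]|(H & q & j & Hd)]]]%in_search_defs; lia.
Qed.

Lemma search_defs_rhs p n f d r :
  In (f, d) (search_defs p n) -> f = 4 \/ f = 5 -> In r (def_rhs d) ->
  r = Done \/ exists rs, r = Fun 5 rs.
Proof.
  intros [[-> ->]|[[-> ->]|[[-> ->]|(H & q & j & Hd)]]]%in_search_defs Hf Hr; try lia.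
  - destruct Hr as [<-|[]]. eauto.
  - destruct Hr as [<-|[<-|[]]]; unfold search_next; eauto.
Qed.

Lemma vars_num n : vars (num n) = [].
Proof.
  induction n as [|n IH]; auto. change (num (S n)) with (Fun 1 [num n]).
  rewrite vars_fun, varsl_cons, IH. reflexivity.
Qed.

Lemma no_zip_num n : no_zip (num n).
Proof. induction n; repeat constructor; auto; discriminate. Qed.

Lemma search_defs_closed p n : closed_rules (search_defs p n).
Proof.
  intros [f d] l r
    [[-> ->]|[[-> ->]|[[-> ->]|(H & q & j & Hd)]]]%in_search_defs Hlr.
  - destruct Hlr as [Hlr|[]]. injection Hlr as <- <-. rewrite vars_num. apply incl_nil_l.
  - destruct Hlr as [Hlr|[]]. injection Hlr as <- <-. intros x. simpl. tauto.
  - destruct Hlr as [Hlr|[Hlr|[]]]; injection Hlr as <- <-; intros x; simpl; tauto.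
  - eapply own_defs_closed; eauto.
Qed.

Lemma search_defs_zip_free p n : zip_free (search_defs p n).
Proof.
  intros f d r [[-> ->]|[[-> ->]|[[-> ->]|(H & q & j & Hd)]]]%in_search_defs Hr.
  - destruct Hr as [<-|[]]. apply no_zip_num.
  - destruct Hr as [<-|[]]. repeat (discriminate || constructor).
  - destruct Hr as [<-|[<-|[]]]; repeat (discriminate || constructor).
  - eapply own_defs_zip_free; eauto.
Qed.

(** * Confluence when every search succeeds *)

Section Search.
Variables (p : rf) (n : nat) (g : nat -> nat -> nat -> nat).
Hypothesis Hg : forall a b c, eval p [a; b; c] (g a b c).

Notation D := (search_defs p n).
Notation R := (search_rules p n).
Notation O := (ctx (oroot D)).

Let Dfun := search_defs_fun p n.
Let Dname := search_defs_name p n.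
Let Dsearch := search_defs_rhs p n.

Lemma rstep_cases t u : rstep R t u -> O t u \/ ctx (union term shift stop) t u.
Proof.
  induction 1 as [l r s H|f ts1 u v ts2 _ [IH|IH]].
  - apply in_search_rules in H as [H|(fd & Hfd & H)].
    + right. apply ctx_root.
      repeat (destruct H as [H|H]; [injection H as <- <-; simpl|]); [..|destruct H].
      * left. apply (shift_l 1).
      * left. apply (shift_r 1).
      * right. apply (stop_done 0).
      * right. apply (stop_run 0).
    + left. apply ctx_root. eapply rule_oroot; eauto using search_defs_closed.
  - left. now constructor.
  - right. now constructor.
Qed.

Lemma rsteps_arg f l1 u v l2 :
  rsteps R u v -> rsteps R (Fun f (l1 ++ u :: l2)) (Fun f (l1 ++ v :: l2)).
Proof.
  induction 1; [apply rt_step; now constructor|apply rt_refl|eapply rt_trans; eauto].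
Qed.

Lemma rsteps_of_ctx rho t u :
  (forall t u, rho t u -> rsteps R t u) -> ctx rho t u -> rsteps R t u.
Proof. intros Hrho. induction 1; auto using rsteps_arg. Qed.

Lemma rsteps_of_star rho t u :
  (forall t u, rho t u -> rsteps R t u) -> star (ctx rho) t u -> rsteps R t u.
Proof.
  intros Hrho. induction 1;
    [eapply rsteps_of_ctx; eauto|apply rt_refl|eapply rt_trans; eauto].
Qed.

Lemma rsteps_of_O t u : star O t u -> rsteps R t u.
Proof.
  apply rsteps_of_star. clear. intros t u H.
  apply oroot_rule in H as (fd & l & r & s & Hfd & Hlr & -> & ->).
  apply rt_step, rs_root, in_search_rules. eauto.
Qed.

Lemma rstep_zip l r s : In (l, r) zip_rules -> rsteps R (subst s l) (subst s r).
Proof. intros H. apply rt_step, rs_root, in_search_rules. auto. Qed.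

Lemma succs_succ k t : succs k (succ t) = succ (succs k t).
Proof. induction k as [|k IH]; auto. exact (f_equal succ IH). Qed.

Lemma rsteps_shift_l k x a : rsteps R (Zip (succs k x) a) (Zip x (succs k a)).
Proof.
  revert a. induction k as [|k IH]; intros a; [apply rt_refl|].
  apply rt_trans with (Zip (succs k x) (succ a)).
  - apply (rstep_zip (Zip (succ (Var 0)) (Var 1)) (Zip (Var 0) (succ (Var 1)))
             (asg [succs k x; a])). simpl. auto.
  - simpl. rewrite <- succs_succ. apply IH.
Qed.

Lemma rsteps_shift_r k x a : rsteps R (Zip x (succs k a)) (Zip (succs k x) a).
Proof.
  revert x. induction k as [|k IH]; intros x; [apply rt_refl|].
  apply rt_trans with (Zip (succ x) (succs k a)).
  - apply (rstep_zip (Zip (Var 0) (succ (Var 1))) (Zip (succ (Var 0)) (Var 1))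
             (asg [x; succs k a])). simpl. auto.
  - simpl. rewrite <- succs_succ. apply IH.
Qed.

Lemma rsteps_of_zip t u : zip D t u -> rsteps R t u.
Proof.
  intros [t' u' []|t' u' [k a|k x]|f ts _ H].
  - apply rsteps_shift_l.
  - apply rsteps_shift_r.
  - eapply rt_trans; [apply rsteps_shift_l|].
    apply (rstep_zip (Zip zero (Var 0)) (Run (Var 0)) (asg [succs k a])). simpl. auto.
  - eapply rt_trans; [apply rsteps_shift_r|].
    apply (rstep_zip (Zip (Var 0) zero) Done (asg [succs k x])). simpl. auto.
  - now apply rsteps_of_O.
Qed.

Lemma eval_call x y :
  star O (call p (num x) (num y)) (num (g n x y)).
Proof.
  apply rt_trans with (Fun (fun_name p 3) (nums [n; x; y])).
  - apply star_args. constructor; [|apply Forall2_star_refl].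
    rewrite <- (subst_num (asg []) n).
    apply (step_plain D 6 0 (num n)); simpl; auto.
  - apply eval_star; auto. intros fd H. simpl. auto.
Qed.

Lemma search_star x y : (exists j, g n x (j + y) = 0) ->
  star O (Search (call p (num x) (num y)) (num y) (num x)) Done.
Proof.
  intros [j Hj]. revert y Hj. induction j as [|j IH]; intros y Hj.
  all: eapply rt_trans; [apply star_args; constructor;
        [apply eval_call|apply Forall2_star_refl]|].
  - simpl in Hj. rewrite Hj. apply (step_zero D 5 2 Done (search_next p) [num y; num x])
      with (2 := eq_refl).
    simpl. auto.
  (* The given zero need not be the least one; a zero met earlier ends the search too. *)
  - destruct (g n x y) as [|z].
    + apply (step_zero D 5 2 Done (search_next p) [num y; num x])
      with (2 := eq_refl). simpl. auto.
    + eapply rt_trans;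
        [apply (step_succ D 5 2 Done (search_next p) (num z) [num y; num x])
      with (2 := eq_refl);
         simpl; auto|].
      apply (IH (S y)). rewrite <- Hj. f_equal. lia.
Qed.

Lemma run_star x : star O (Run (num x))
  (Search (call p (num x) zero) zero (num x)).
Proof.
  apply (step_plain D 4 1 (Search (call p (Var 0) zero) zero (Var 0)) [num x])
    with (2 := eq_refl).
  simpl. auto.
Qed.

(** The compressed relation is larger than rewriting step by step, but each of its steps is a
    sequence of rewrite steps. Both therefore have the same reflexive-transitive closure, and
    confluence carries over. *)
Lemma search_confluent : (forall x, exists y, g n x y = 0) ->
  forall t t1 t2, rsteps R t t1 -> rsteps R t t2 ->
    exists d, rsteps R t1 d /\ rsteps R t2 d.
Proof.
  intros Hall t t1 t2 H1 H2.
  assert (forall t u, rsteps R t u -> star (union term (star O) (par (zip D))) t u) as Hin.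
  { clear -Dname. induction 1 as [t u H| |];
      [apply rt_step|apply rt_refl|eapply rt_trans; eauto].
    apply rstep_cases in H as [H|H]; [left; now apply rt_step|right].
    apply par_of_ctx; auto using zip_defined.
    induction H as [t u [H|H]|]; [apply ctx_root|apply ctx_root|now constructor].
    - now apply zip_shift.
    - now apply zip_stop. }
  assert (forall t u, star (union term (star O) (par (zip D))) t u -> rsteps R t u) as Hout.
  { clear -Dname. induction 1 as [t u [H|H]| |];
      [now apply rsteps_of_O| |apply rt_refl|eapply rt_trans; eauto].
    apply star_of_par in H; auto using zip_defined.
    exact (rsteps_of_star _ _ _ rsteps_of_zip H). }
  destruct (zip_union_confluent D Dfun Dname Dsearch) with (t := t) (s := t1) (u := t2)
    as (w & Hw1 & Hw2); auto.
  - intros x. eapply rt_trans; [apply run_star|]. apply (search_star x 0).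
    destruct (Hall x) as [y Hy]. exists y. now rewrite Nat.add_0_r.
  - exists w. auto.
Qed.

(** * Reducts of an unsuccessful search *)

Lemma no_zip_step t u : rstep R t u -> no_zip t -> O t u /\ no_zip u.
Proof.
  assert (forall s r, (forall x, no_zip (s x)) -> no_zip r -> no_zip (subst s r)) as Hsub.
  { intros s r Hs. induction r as [x|f ts IH] using term_ind'; intros H; simpl; auto.
    inversion H as [|? ? Hf Hts]; subst. constructor; auto.
    clear -IH Hts. induction Hts; inversion IH; simpl; auto. }
  assert (forall ts, Forall no_zip ts -> forall x, no_zip (asg ts x)) as Hasg.
  { intros ts H. induction H as [|t' ts Ht _ IH]; intros [|x]; simpl; auto;
      try apply (no_zip_num 0). apply IH. }
  intros [H|H]%rstep_cases Ht.
  - split; auto. induction H as [t u Hr|f l1 u v l2 _ IH].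
    + destruct Hr as [f k r ts Hd|f k r0 r1 ts Hd|f k r0 r1 t ts Hd];
        inversion Ht as [|? ? _ Hts]; subst;
        apply Hsub; try (eapply search_defs_zip_free; [eauto|simpl; auto]; fail);
        apply Hasg; auto.
      inversion Hts as [|? ? Hs Hts']; subst. inversion Hs as [|? ? _ Hs']; subst.
      inversion Hs'; auto.
    + inversion Ht as [|? ? Hf Hts]; subst. apply Forall_app in Hts as [H1 H2].
      inversion H2; subst. constructor; auto. apply Forall_app. auto.
  - exfalso. induction H as [t u H|f l1 u v l2 _ IH].
    + destruct H as [H|H]; destruct H; inversion Ht; congruence.
    + inversion Ht as [|? ? Hf Hts]; subst. apply Forall_app in Hts as [_ H2].
      inversion H2; auto.
Qed.

Lemma O_fun_inv f ts t : O (Fun f ts) t ->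
  oroot D (Fun f ts) t \/ exists us, t = Fun f us /\ Forall2 (star O) ts us.
Proof.
  inversion 1 as [|? l1 u v l2 Huv]; subst; auto. right. eexists. split; eauto.
  apply Forall2_app; [apply Forall2_star_refl|].
  constructor; [now apply rt_step|apply Forall2_star_refl].
Qed.

(* Contains all reducts of [Run (num x)] when the search never succeeds. *)
Inductive searching (x : nat) : term -> Prop :=
| searching_run w : star O w (num x) -> searching x (Run w)
| searching_at u v w y z : star O u (num (S z)) -> star O v (num y) ->
    star O w (num x) -> searching x (Search u v w).

Lemma searching_call x y v w : g n x y <> 0 ->
  star O v (num y) -> star O w (num x) ->
  searching x (Search (call p w v) v w).
Proof.
  intros Hy Hv Hw. apply searching_at with y (pred (g n x y)); auto.
  replace (S (pred (g n x y))) with (g n x y) by lia.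
  eapply rt_trans; [|apply eval_call].
  apply star_args. auto using rt_refl.
Qed.

(** The invariant records only which numerals the arguments reduce to, so [star_O_num] preserves it
    under steps inside arguments. A root step moves to the next candidate, whose value is again
    nonzero. *)
Lemma searching_step x t u : (forall y, g n x y <> 0) ->
  O t u -> searching x t -> searching x u.
Proof.
  intros Hno H Ht. pose proof (star_O_num D Dfun Dname) as Hnum.
  destruct Ht as [w Hw|u0 v w y z Hu Hv Hw]; apply O_fun_inv in H as [H|(us & -> & H)].
  - inversion H as [? k r ts Hd E|? k r0 r1 ts Hd E|? k r0 r1 t ts Hd E]; subst;
      apply in_search_defs in Hd
        as [[E' Hd]|[[E' Hd]|[[E' Hd]|[E' _]]]]; try discriminate; try lia.
    injection Hd as ->. apply (searching_call x 0); auto using rt_refl.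
  - inversion H as [|? w' ? ? Hw' Hn]; subst. inversion Hn; subst.
    constructor. eauto.
  - inversion H as [? k r ts Hd E|? k r0 r1 ts Hd E|? k r0 r1 t ts Hd E]; subst;
      apply in_search_defs in Hd
        as [[E' Hd]|[[E' Hd]|[[E' Hd]|[E' _]]]]; try discriminate; try lia.
    (* The rule to [Done] would need [zero] as first argument, but that argument reduces to a
       positive numeral. *)
    + apply (star_zero _ (oroot_defined D Dname)) in Hu. discriminate.
    + injection Hd as -> ->. apply (searching_call x (S y)); auto.
      apply (star_succs _ 1). exact Hv.
  - inversion H as [|? u' ? ? Hu' H1]; subst. inversion H1 as [|? v' ? ? Hv' H2]; subst.
    inversion H2 as [|? w' ? ? Hw' Hn]; subst. inversion Hn; subst.
    econstructor; eauto.
Qed.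

Lemma searching_forever x t : (forall y, g n x y <> 0) ->
  rsteps R (Run (num x)) t -> searching x t.
Proof.
  intros Hno H.
  assert (no_zip (Run (num x)) /\ searching x (Run (num x))) as H0.
  { split; [repeat constructor; auto using no_zip_num; discriminate|].
    constructor. apply rt_refl. }
  apply clos_rt_rt1n in H. induction H as [t|t u v Htu _ IH]; [tauto|].
  destruct H0 as [Hz Ht]. apply no_zip_step in Htu as [Htu Hu]; auto.
  apply IH. eauto using searching_step.
Qed.

Lemma rsteps_Done t : rsteps R Done t -> t = Done.
Proof.
  intros H. apply clos_rt_rt1n in H. inversion H as [|? ? H1 _]; auto. exfalso.
  apply rstep_cases in H1 as [H1|H1]; inversion H1 as [? ? H2|? l1]; subst;
    try (destruct l1; discriminate).
  - apply oroot_name with (1 := Dname) in H2. lia.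
  - destruct H2 as [H2|H2]; inversion H2.
Qed.

Lemma search_joinable_inv x :
  (exists d, rsteps R (Run (num x)) d /\ rsteps R Done d) -> ~ forall y, g n x y <> 0.
Proof.
  intros (d & H1 & H2%rsteps_Done) Hno. subst d.
  apply searching_forever in H1; auto. inversion H1.
Qed.
End Search.

(** * The reduction *)

Fixpoint syms (t : term) : list (nat * nat) :=
  match t with
  | Var _ => []
  | Fun f ts => (f, length ts) :: flat_map syms ts
  end.

Lemma wf_syms sig t : incl (syms t) sig -> wf_term sig t.
Proof.
  induction t as [x|f ts IH] using term_ind'; intros H; [exact I|].
  apply wf_fun. simpl in H. apply incl_cons_inv in H as [Hf H]. split; auto.
  clear Hf. induction IH as [|t ts Ht _ IHts]; auto.
  simpl in H. apply incl_app_inv in H as [H1 H2]. auto.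
Qed.

(** Collected from the rules that do not mention [n], so that its code is a constant of the
    reduction; the numeral of [n] uses only symbols 0 and 1, which occur there. *)
Definition search_sig (p : rf) : signature :=
  (6, 0) :: flat_map (fun lr => syms (fst lr) ++ syms (snd lr)) (fixed_rules p).

Lemma search_sig_zip p :
  In (0, 0) (search_sig p) /\ In (1, 1) (search_sig p) /\ In (2, 2) (search_sig p).
Proof. repeat split; repeat first [left; reflexivity | right]. Qed.

Lemma wf_num p n : wf_term (search_sig p) (num n).
Proof.
  destruct (search_sig_zip p) as (H0 & H1 & _). induction n as [|n IH].
  - apply wf_fun. auto.
  - apply (wf_fun _ 1 [num n]). auto.
Qed.

Definition search_trs (p : rf) (n : nat) : TRS :=
  mkTRS (search_sig p) (search_rules p n).

Lemma search_trs_wf p n : wf_trs (search_trs p n).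
Proof.
  intros l r H. split; [|split].
  - apply in_search_rules in H as [H|([f [k r'|k r0 r1]] & _ & H)]; simpl in H;
      repeat (destruct H as [H|H]; [injection H as <- <-; discriminate|]); destruct H.
  - apply in_search_rules in H as [H|(fd & Hfd & H)].
    + repeat (destruct H as [H|H]; [injection H as <- <-; intros x; simpl; tauto|]).
      destruct H.
    + eapply search_defs_closed; eauto.
  - simpl. destruct H as [H|H].
    + injection H as <- <-. split; [apply wf_fun; simpl; auto|apply wf_num].
    + split; apply wf_syms; intros s Hs; right; apply in_flat_map;
        exists (l, r); split; auto; apply in_or_app; auto.
Qed.

Section Reduction.
Variables (p : rf) (g : nat -> nat -> nat -> nat).
Hypothesis Hg : forall a b c, eval p [a; b; c] (g a b c).

Lemma search_trs_confluent n :
  (forall x, exists y, g n x y = 0) -> confluent (search_trs p n).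
Proof.
  intros H t _ t1 t2. apply (search_confluent p n g Hg H).
Qed.

Lemma search_trs_ground_confluent n :
  ground_confluent (search_trs p n) -> forall x, exists y, g n x y = 0.
Proof.
  intros H x. apply NNPP. intros Hno.
  apply (search_joinable_inv p n g Hg x); [|intros y Hy; apply Hno; eauto].
  destruct (search_sig_zip p) as (H0 & _ & H2).
  (* This ground term can exit to [Run (num x)] at once, and to [Done] after all [x] successors are
     shifted to the left. *)
  destruct (H (Zip zero (num x))) with (t1 := Run (num x)) (t2 := Done) as (d & H3 & H4).
  - apply wf_fun. split; auto. constructor.
    + apply wf_fun. auto.
    + constructor; [apply wf_num|constructor].
  - unfold ground. rewrite vars_fun, !varsl_cons, vars_num. reflexivity.
  - apply rsteps_of_zip, zip_stop, (stop_run 0).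
  - apply rsteps_of_zip, zip_stop, (stop_done x).
  - eauto.
Qed.

Definition enc_rules (rs : list (term * term)) : nat :=
  encl (map (fun lr => pr (enc (fst lr)) (enc (snd lr))) rs).

Lemma drules_enc rs : drules (enc_rules rs) = rs.
Proof.
  unfold drules, enc_rules. rewrite dl_encl, map_map.
  rewrite <- (map_id rs) at 2. apply map_ext. intros [l r].
  unfold dpair. rewrite pfst_pr, psnd_pr, !decode_enc. reflexivity.
Qed.

Definition search_code (n : nat) : nat :=
  pr (encl (map to_nat (search_sig p))) (enc_rules (search_rules p n)).

Lemma decode_search_code n : decode_trs (search_code n) = search_trs p n.
Proof.
  unfold search_code. rewrite decode_trs_pr, pfst_pr, psnd_pr, drules_enc.
  unfold search_trs. f_equal. unfold dsig. rewrite dl_encl, map_map.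
  rewrite <- (map_id (search_sig p)) at 2. apply map_ext. intros. apply cancel_of_to.
Qed.

Lemma computable_search_code : computable1 search_code.
Proof.
  assert (recursive 1 (fun v => enc (num (nth 0 v 0)))) as Hnum.
  (* Symbol 1 has the tag [S 1], and its one-element argument list is coded by [S (pr z 0)]. *)
  { apply (recursive_ext 1 (fun v => nat_rec (fun _ => nat) (enc zero)
                      (fun _ z => pr 2 (S (pr z 0))) (nth 0 v 0))).
    - intros v _. induction (nth 0 v 0) as [|n IH]; auto.
      change (enc (num (S n))) with (pr 2 (S (pr (enc (num n)) 0))).
      rewrite <- IH. reflexivity.
    - apply (recursive_rec 1 (fun _ => enc zero) (fun _ z _ => pr 2 (S (pr z 0))));
        auto 10 with recursive. }
  (* Only the right-hand side of the first rule varies with [n]; the signature and all other rules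
     have constant codes. *)
  assert (recursive 1 (fun v => pr (encl (map to_nat (search_sig p)))
    (S (pr (pr (enc (Fun 6 [])) (enc (num (nth 0 v 0)))) (enc_rules (fixed_rules p))))))
    as [q Hq] by auto 20 with recursive.
  exists q. intros n. apply (Hq [n]). reflexivity.
Qed.
End Reduction.

Lemma confluent_ground R : confluent R -> ground_confluent R.
Proof. intros H t Ht _. auto. Qed.

(** One reduction serves every set between [CONF] and [GCONF]: success of all searches yields
    confluence on all terms, and ground confluence alone already forces all searches to succeed. *)
Lemma Pi02_hard (B : nat -> Prop) :
  (forall n, CONF n -> B n) -> (forall n, B n -> GCONF n) ->
  forall A, Pi02 A -> many_one_reducible A B.
Proof.
  intros HB1 HB2 A (g & [p Hg] & HA). exists (search_code p). split.
  - apply computable_search_code.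
  - intros n. rewrite HA. split.
    + intros H. apply HB1. unfold CONF. rewrite decode_search_code.
      split; [apply search_trs_wf|now apply (search_trs_confluent p g)].
    + intros H%HB2. unfold GCONF in H. rewrite decode_search_code in H.
      now apply (search_trs_ground_confluent p g).
Qed.

Theorem theorem3 : Pi02_complete CONF /\ Pi02_complete GCONF.
Proof.
  assert (forall n, CONF n -> GCONF n) as H
    by (intros n [H1 H2]; split; auto using confluent_ground).
  split; split; auto using Pi02_CONF, Pi02_GCONF, Pi02_hard.
Qed.
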